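(* Let $\Bbbk$ be a commutative unital ring and $q\in\Bbbk^\times$. Let $\pi^{(n)}\colon\mathcal V_{n-1}\otimes V\to\mathcal V_n$ ($n\ge1$) be the inclusion of $\mathcal V_{n-1}\otimes V$ as the subcomplex of $\mathcal V_n$ spanned by those pairings in which the rightmost dot does not belong to a pair, where $V$ is the object $1$ of $\mathcal{TL}$. Then the data $\{\mathcal V_n,\pi^{(n)}\}_{n\ge0}$ (with self-dual object $V$, whose coevaluation and evaluation are the cup and the cap) is a Chebyshev system in $\mathcal K^b(\mathcal{TL})$; that is, the $\mathcal V_n$ are bounded complexes over $\mathcal{TL}$ satisfying the axioms of a Chebyshev system with the distinguished triangles taken in the bounded homotopy category $\mathcal K^b(\mathcal{TL})$.
   Context: $\mathcal{TL}$ is the $\Bbbk$-linear monoidal category with objects $n\in\mathbb Z_{\ge0}$ and morphisms $n\to m$ the $\Bbbk$-linear combinations of isotopy classes of flat tangles in $I^2$ with $n$ bottom and $m$ top endpoints, modulo replacing a closed circle by $q+q^{-1}$; composition is vertical stacking, $\otimes$ juxtaposition. Finite direct sums are understood to be adjoined. **The complex $\mathcal V_n$.** Place dots $1,\dots,n$ on a line. A $k$-pairing is a choice of $k$ disjoint pairs of neighbouring dots; $I_{k,n}$ is the set of $k$-pairings. For $s\in I_{k,n}$ let $\mathcal V_s$ be the object $n-2k$ of $\mathcal{TL}$. Then $\mathcal V_n^{-k}=\bigoplus_{s\in I_{k,n}}\mathcal V_s$ (zero unless $0\le k\le\lfloor n/2\rfloor$). The component $\mathcal V_s\to\mathcal V_{s'}$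 of the differential $\mathcal V_n^{-k}\to\mathcal V_n^{-k+1}$ is $0$ unless $s=s'\cup\{p\}$ for a single pair $p$; in that case it is $(-1)^{(s,s')}$ times the flat tangle $n-2k\to n-2k+2$ consisting of vertical strands and one cup having exactly $i$ strands to its left, where $i$ is the number of dots unpaired in $s$ lying to the left of $p$, and $(s,s')$ is the number of pairs in $s$ lying to the right of $p$. **Chebyshev system** in a monoidal category $(\mathcal C,\otimes,\mathbf 1)$: a self-dual object $(V,\mathrm{ev},\mathrm{coev})$ (maps $\mathrm{coev}\colon\mathbf 1\to V\otimes V$, $\mathrm{ev}\colon V\otimes V\to\mathbf 1$ with $(\mathrm{id}_V\otimes\mathrm{ev})(\mathrm{coev}\otimes\mathrm{id}_V)=\mathrm{id}_V=(\mathrm{ev}\otimes\mathrm{id}_V)(\mathrm{id}_V\otimes\mathrm{coev})$), bounded above complexes $V^{(n)}$ over $\mathcal C$ with $V^{(0)}=\mathbf 1$, $V^{(1)}=V$, and chain maps $\pi^{(n)}\colon V^{(n-1)}\otimes V\to V^{(n)}$ ($n\ge1$), such that $\pi^{(1)}\colon\mathbf 1\otimes V\to V$ is the canonical isomorphism and for each $n\ge2$ there is a distinguished triangle $V^{(n-2)}\xrightarrow{\iota^{(n-2)}}V^{(n-1)}\otimes V\xrightarrow{\pi^{(n)}}V^{(n)}\to V^{(n-2)}[1]$ in the homotopy category of complexes over $\mathcal C$, where $\iota^{(n-2)}=(\pi^{(n-1)}\otimes\mathrm{id}_V)\circ(\mathrm{id}_{V^{(n-2)}}\otimes\mathrm{coev})$.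 *)

(* Defs.v *)
From HB Require Import structures.
From mathcomp Require Import all_boot all_order all_algebra.

Set Implicit Arguments.
Unset Strict Implicit.
Unset Printing Implicit Defensive.

Import GRing.Theory.
Local Open Scope ring_scope.

(** * Monoidal linear categories and their additive closure *)

(* The operations of a k-linear monoidal category.  The axioms are not part of
   the record: it is instantiated below at the Temperley-Lieb category, whose
   operations are given explicitly.
   [homC f g] is "f after g"; [assoc] goes (a b) c -> a (b c). *)
Record monCat (k : comPzRingType) := MonCat {
  ob :> Type;
  hom : ob -> ob -> lmodType k;
  homI : forall a, hom a a;
  homC : forall a b c, hom b c -> hom a b -> hom a c;
  tunit : ob;
  tob : ob -> ob -> ob;
  thom : forall a b c d, hom a b -> hom c d -> hom (tob a c) (tob b d);
  assoc : forall a b c, hom (tob (tob a b) c) (tob a (tob b c));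
  assocV : forall a b c, hom (tob a (tob b c)) (tob (tob a b) c);
  lunit : forall a, hom (tob tunit a) a;
  lunitV : forall a, hom a (tob tunit a);
  runit : forall a, hom (tob a tunit) a;
  runitV : forall a, hom a (tob a tunit)
}.

Section AdditiveClosure.
Variables (k : comPzRingType) (C : monCat k).

(* Finite formal direct sums of objects; morphisms are matrices of morphisms,
   the entry at (i, j) going from the i-th summand of the source to the j-th
   summand of the target. *)
Record dsum := DSum { idx : finType; summand :> idx -> ob C }.

Record mor (X Y : dsum) :=
  Mor { entry :> forall (i : idx X) (j : idx Y), hom (X i) (Y j) }.

Definition zerom (X Y : dsum) : mor X Y := Mor (fun i j => 0).

Definition addm (X Y : dsum) (f g : mor X Y) : mor X Y :=
  Mor (fun i j => f i j + g i j).
Definition oppm (X Y : dsum) (f : mor X Y) : mor X Y :=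
  Mor (fun i j => - f i j).

Definition compm (X Y Z : dsum) (g : mor Y Z) (f : mor X Y) : mor X Z :=
  Mor (fun i l => \sum_(j : idx Y) homC (g j l) (f i j)).

(* The matrix whose only nonzero entries are the [f i], at position (i, g i). *)
Definition monomialm (X Y : dsum) (g : idx X -> idx Y)
    (f : forall i, hom (X i) (Y (g i))) : mor X Y :=
  Mor (fun i j =>
    if g i =P j is ReflectT e then ecast j (hom (X i) (Y j)) e (f i) else 0).

Definition idm (X : dsum) : mor X X :=
  @monomialm X X id (fun i => homI (X i)).

Definition osum (a : ob C) : dsum := DSum (fun _ : unit => a).

Definition unitd : dsum := osum (tunit C).

Definition tensd (X Y : dsum) : dsum :=
  DSum (fun ij : idx X * idx Y => tob (X ij.1) (Y ij.2)).

Definition tensm (X X' Y Y' : dsum) (f : mor X X') (g : mor Y Y') :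
    mor (tensd X Y) (tensd X' Y') :=
  @Mor (tensd X Y) (tensd X' Y') (fun i j => thom (f i.1 j.1) (g i.2 j.2)).

Definition assocm (X Y Z : dsum) :
    mor (tensd (tensd X Y) Z) (tensd X (tensd Y Z)) :=
  @monomialm (tensd (tensd X Y) Z) (tensd X (tensd Y Z))
    (fun i => (i.1.1, (i.1.2, i.2)))
    (fun i => assoc (X i.1.1) (Y i.1.2) (Z i.2)).

Definition assocmV (X Y Z : dsum) :
    mor (tensd X (tensd Y Z)) (tensd (tensd X Y) Z) :=
  @monomialm (tensd X (tensd Y Z)) (tensd (tensd X Y) Z)
    (fun i => ((i.1, i.2.1), i.2.2))
    (fun i => assocV (X i.1) (Y i.2.1) (Z i.2.2)).

Definition lunitm (X : dsum) : mor (tensd unitd X) X :=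
  @monomialm (tensd unitd X) X (fun i => i.2) (fun i => lunit (X i.2)).

Definition lunitmV (X : dsum) : mor X (tensd unitd X) :=
  @monomialm X (tensd unitd X) (fun i => (tt, i)) (fun i => lunitV (X i)).

Definition runitm (X : dsum) : mor (tensd X unitd) X :=
  @monomialm (tensd X unitd) X (fun i => i.1) (fun i => runit (X i.1)).

Definition runitmV (X : dsum) : mor X (tensd X unitd) :=
  @monomialm X (tensd X unitd) (fun i => (i, tt)) (fun i => runitV (X i)).

Definition zero_object (X : dsum) : Prop := idm X = zerom X X.

Definition biprod (X Y : dsum) : dsum :=
  DSum (fun x : idx X + idx Y =>
          match x with inl i => X i | inr j => Y j end).

Definition blockm (X Y X' Y' : dsum) (fXX : mor X X') (fXY : mor X Y')
    (fYX : mor Y X') (fYY : mor Y Y') : mor (biprod X Y) (biprod X' Y') :=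
  @Mor (biprod X Y) (biprod X' Y') (fun i j => match i, j with
    | inl a, inl b => fXX a b
    | inl a, inr b => fXY a b
    | inr a, inl b => fYX a b
    | inr a, inr b => fYY a b
    end).

Definition inrm (X Y : dsum) : mor Y (biprod X Y) :=
  @Mor Y (biprod X Y) (fun i j =>
    match j with inl b => zerom Y X i b | inr b => idm Y i b end).

Definition prlm (X Y : dsum) : mor (biprod X Y) X :=
  @Mor (biprod X Y) X (fun i j =>
    match i with inl a => idm X a j | inr a => zerom Y X a j end).

(** * Complexes, homotopies and distinguished triangles *)

(* Cohomological grading; the equation d d = 0 is the predicate [is_complex]. *)
Record cplx := Cplx {
  deg :> int -> dsum;
  diff : forall i : int, mor (deg i) (deg (i + 1))
}.

Definition is_complex (X : cplx) : Prop :=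
  forall i, compm (diff X (i + 1)) (diff X i) = zerom (X i) (X (i + 1 + 1)).

Definition bounded_above (X : cplx) : Prop :=
  exists N : int, forall i : int, N < i -> zero_object (X i).

Definition bounded (X : cplx) : Prop :=
  exists N : int, forall i : int, N < `|i| -> zero_object (X i).

Definition gmap (X Y : cplx) := forall i : int, mor (X i) (Y i).

Definition gid (X : cplx) : gmap X X := fun i => idm (X i).

Definition gcomp (X Y Z : cplx) (g : gmap Y Z) (f : gmap X Y) : gmap X Z :=
  fun i => compm (g i) (f i).

Definition chain_map (X Y : cplx) (f : gmap X Y) : Prop :=
  forall i, compm (diff Y i) (f i) = compm (f (i + 1)) (diff X i).

(* A homotopy has components h i : X^(i+1) -> Y^i.  Every integer is of the
   form i + 1, so the condition covers all degrees. *)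
Definition homotopic (X Y : cplx) (f g : gmap X Y) : Prop :=
  exists h : forall i : int, mor (X (i + 1)) (Y i),
    forall i,
      addm (f (i + 1)) (oppm (g (i + 1))) =
      addm (compm (diff Y i) (h i)) (compm (h (i + 1)) (diff X (i + 1))).

Definition cplx_iso (X Y : cplx) (f : gmap X Y) : Prop :=
  chain_map f /\
  exists g : gmap Y X,
    [/\ chain_map g, gcomp g f = gid X & gcomp f g = gid Y].

Definition homotopy_iso (X Y : cplx) (f : gmap X Y) : Prop :=
  chain_map f /\
  exists g : gmap Y X,
    [/\ chain_map g, homotopic (gcomp g f) (gid X)
      & homotopic (gcomp f g) (gid Y)].

Definition shift (X : cplx) : cplx :=
  Cplx (fun i => oppm (diff X (i + 1))).

Definition gshift (X Y : cplx) (f : gmap X Y) : gmap (shift X) (shift Y) :=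
  fun i => f (i + 1).

Definition cone (X Y : cplx) (f : gmap X Y) : cplx :=
  @Cplx (fun i => biprod (X (i + 1)) (Y i))
    (fun i => blockm (oppm (diff X (i + 1))) (f (i + 1))
                     (zerom (Y i) (X (i + 1 + 1))) (diff Y i)).

Definition cone_in (X Y : cplx) (f : gmap X Y) : gmap Y (cone f) :=
  fun i => inrm (X (i + 1)) (Y i).

Definition cone_pr (X Y : cplx) (f : gmap X Y) : gmap (cone f) (shift X) :=
  fun i => prlm (X (i + 1)) (Y i).

(* Distinguished triangles in the full subcategory of the homotopy category on
   the complexes satisfying [B]: triangles isomorphic there to a triangle
   X' -> Y' -> cone f' -> X'[1]. *)
Definition distinguished (B : cplx -> Prop) (X Y Z : cplx)
    (f : gmap X Y) (g : gmap Y Z) (h : gmap Z (shift X)) : Prop :=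
  [/\ chain_map f, chain_map g, chain_map h &
   exists (X' Y' : cplx) (f' : gmap X' Y'),
   exists (a : gmap X X') (b : gmap Y Y') (c : gmap Z (cone f')),
   [/\ [/\ is_complex X', B X', is_complex Y', B Y' & chain_map f'],
       [/\ homotopy_iso a, homotopy_iso b & homotopy_iso c] &
       [/\ homotopic (gcomp b f) (gcomp f' a),
           homotopic (gcomp c g) (gcomp (cone_in f') b) &
           homotopic (gcomp (gshift a) h) (gcomp (cone_pr f') c)]]].

(* X placed in degree 0; the summands in degree i are indexed by the
   x : idx X such that i = 0. *)
Definition stalk_dsum (X : dsum) (i : int) : dsum :=
  DSum (fun x : {x : idx X | i == 0} => X (val x)).

Definition stalk (X : dsum) : cplx :=
  @Cplx (stalk_dsum X)
    (fun i => zerom (stalk_dsum X i) (stalk_dsum X (i + 1))).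

Definition tensc (X : cplx) (V : dsum) : cplx :=
  @Cplx (fun i => tensd (X i) V) (fun i => tensm (diff X i) (idm V)).

Definition tensg (X Y : cplx) (V : dsum) (f : gmap X Y) :
    gmap (tensc X V) (tensc Y V) :=
  fun i => tensm (f i) (idm V).

Definition stalk_lunit (V : dsum) : gmap (tensc (stalk unitd) V) (stalk V) :=
  fun i =>
    @monomialm (tensd (stalk_dsum unitd i) V) (stalk_dsum V i)
      (fun x => exist (fun _ : idx V => i == 0) x.2 (valP x.1))
      (fun x => lunit (V x.2)).

(** * Chebyshev systems *)

Definition self_dual (V : dsum) (ev : mor (tensd V V) unitd)
    (coev : mor unitd (tensd V V)) : Prop :=
  compm (runitm V)
    (compm (tensm (idm V) ev)
      (compm (assocm V V V)
        (compm (tensm coev (idm V)) (lunitmV V)))) = idm V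
  /\
  compm (lunitm V)
    (compm (tensm ev (idm V))
      (compm (assocmV V V V)
        (compm (tensm (idm V) coev) (runitmV V)))) = idm V.

(* X -> X V V, the tensor product of X with the coevaluation. *)
Definition coev_tens (V : dsum) (coev : mor unitd (tensd V V)) (X : cplx) :
    gmap X (tensc (tensc X V) V) :=
  fun i =>
    compm (assocmV (X i) V V) (compm (tensm (idm (X i)) coev) (runitmV (X i))).

(* iota^(n), for pi n : W n V -> W (n+1), which is the map pi^(n+1). *)
Definition cheb_iota (V : dsum) (coev : mor unitd (tensd V V))
    (W : nat -> cplx) (pi : forall n, gmap (tensc (W n) V) (W n.+1)) (n : nat) :
    gmap (W n) (tensc (W n.+1) V) :=
  gcomp (tensg V (pi n)) (coev_tens coev (W n)).

(* A Chebyshev system in the homotopy category of the complexes satisfying [B]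
   (for instance [bounded] for K^b): the W n satisfy [B] and the triangles are
   distinguished in that category.  The identifications 1 = W 0 and V = W 1 are
   given as isomorphisms of complexes e0 and e1. *)
Record chebyshev_system (B : cplx -> Prop) (V : dsum)
    (ev : mor (tensd V V) unitd) (coev : mor unitd (tensd V V))
    (W : nat -> cplx)
    (e0 : gmap (stalk unitd) (W 0%N)) (e1 : gmap (stalk V) (W 1%N))
    (pi : forall n, gmap (tensc (W n) V) (W n.+1)) : Prop := {
  cheb_dual : self_dual ev coev;
  cheb_complex : forall n, is_complex (W n);
  cheb_bounded_above : forall n, bounded_above (W n);
  cheb_class : forall n, B (W n);
  cheb_iso0 : cplx_iso e0;
  cheb_iso1 : cplx_iso e1;
  cheb_chain : forall n, chain_map (pi n);
  cheb_pi1 : gcomp (pi 0%N) (tensg V e0) = gcomp e1 (stalk_lunit V);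
  cheb_triangle : forall n, exists h : gmap (W n.+2) (shift (W n)),
    distinguished B (cheb_iota coev pi n) (pi n.+1) h
}.

End AdditiveClosure.

(** * The Temperley-Lieb category *)

(* Endpoints of a tangle from a to b: bottom points [inl i] and top points
   [inr j], both numbered from left to right. *)
Definition bpos (a b : nat) (x : 'I_a + 'I_b) : nat :=
  match x with inl i => i | inr j => (a + rev_ord j)%N end.

Definition crossing (a b : nat)
    (t : {ffun 'I_a + 'I_b -> 'I_a + 'I_b}) (x y : 'I_a + 'I_b) : bool :=
  [&& bpos x < bpos y, bpos y < bpos (t x) & bpos (t x) < bpos (t y)]%N.

(* Isotopy classes of flat tangles without closed components: fixed-point-free
   noncrossing involutions of the endpoints, which [bpos] orders along the
   boundary of the square. *)
Definition is_flat (a b : nat) (t : {ffun 'I_a + 'I_b -> 'I_a + 'I_b}) : bool :=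
  [forall x, (t x != x) && (t (t x) == x)]
  && [forall x, forall y, ~~ crossing t x y].

Definition tangle (a b : nat) :=
  {t : {ffun 'I_a + 'I_b -> 'I_a + 'I_b} | is_flat t}.

Section Stacking.
Variables a b c : nat.

(* The points of a stack of beta : b -> c on top of alpha : a -> b. *)
Definition stack_pt : finType := (('I_a + 'I_b) + 'I_c)%type.

Definition lower (u : 'I_a + 'I_b) : stack_pt := inl u.
Definition upper (v : 'I_b + 'I_c) : stack_pt :=
  match v with inl j => inl (inr j) | inr l => inr l end.
Definition outer (w : 'I_a + 'I_c) : stack_pt :=
  match w with inl i => inl (inl i) | inr l => inr l end.

Definition glue (beta : tangle b c) (alpha : tangle a b) : rel stack_pt :=
  fun x y =>
    [exists u, (x == lower u) && (y == lower (val alpha u))]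
    || [exists v, (x == upper v) && (y == upper (val beta v))].

(* gamma is the stack with its closed circles removed. *)
Definition is_stack (beta : tangle b c) (alpha : tangle a b)
    (gamma : tangle a c) : bool :=
  [forall w, connect (glue beta alpha) (outer w) (outer (val gamma w))].

Definition circles (beta : tangle b c) (alpha : tangle a b) : nat :=
  n_comp (glue beta alpha)
    [pred x | [forall w, ~~ connect (glue beta alpha) x (outer w)]].

End Stacking.

Definition juxt_l (a b c d : nat) (x : 'I_a + 'I_b) : 'I_(a + c) + 'I_(b + d) :=
  match x with inl i => inl (lshift c i) | inr j => inr (lshift d j) end.
Definition juxt_r (a b c d : nat) (x : 'I_c + 'I_d) : 'I_(a + c) + 'I_(b + d) :=
  match x with inl i => inl (rshift a i) | inr j => inr (rshift b j) end.

Definition is_juxt (a b c d : nat) (alpha : tangle a b) (beta : tangle c d)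
    (gamma : tangle (a + c) (b + d)) : bool :=
  [forall x, val gamma (juxt_l c d x) == juxt_l c d (val alpha x)]
  && [forall y, val gamma (juxt_r a b y) == juxt_r a b (val beta y)].

Section TemperleyLieb.
Variables (k : comPzRingType) (delta : k).

Definition tl_hom (a b : nat) : lmodType k := {ffun tangle a b -> k^o}.

(* The tangle singled out by P, for P satisfied by at most one tangle. *)
Definition tl_diag (a b : nat) (P : pred (tangle a b)) : tl_hom a b :=
  [ffun t => (P t)%:R].

(* The vertical strands, for a = b (a propositional equality of numbers). *)
Definition tl_id (a b : nat) : tl_hom a b :=
  tl_diag (fun t => (a == b)
    && [forall i, forall j, (val t (inl i) == inr j) == (i == j :> nat)]).

(* Vertical strands and one cup with i strands to its left, for b = a + 2: all
   bottom points go to the top points other than the i-th and (i+1)-st (counted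
   from 0), so these two are joined by the cup.  A cap is a reflected cup. *)
Definition tl_cup (i a b : nat) : tl_hom a b :=
  tl_diag (fun t => [&& b == a.+2, (i <= a)%N &
    [forall x, forall y, (val t (inl x) == inr y)
       == (y == (if (x < i)%N then (x : nat) else x.+2) :> nat)]]).

Definition tl_cap (i a b : nat) : tl_hom a b :=
  tl_diag (fun t => [&& a == b.+2, (i <= b)%N &
    [forall x, forall y, (val t (inr x) == inl y)
       == (y == (if (x < i)%N then (x : nat) else x.+2) :> nat)]]).

(* Bilinear extensions of stacking, each closed circle contributing a factor
   delta, and of juxtaposition. *)
Definition tl_comp (a b c : nat) (g : tl_hom b c) (f : tl_hom a b) :
    tl_hom a c :=
  [ffun gamma => \sum_(alpha : tangle a b)
     \sum_(beta : tangle b c | is_stack beta alpha gamma)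
       (g beta : k) * (f alpha : k) * delta ^+ circles beta alpha].

Definition tl_tens (a b c d : nat) (f : tl_hom a b) (g : tl_hom c d) :
    tl_hom (a + c) (b + d) :=
  [ffun gamma => \sum_(alpha : tangle a b)
     \sum_(beta : tangle c d | is_juxt alpha beta gamma)
       (f alpha : k) * (g beta : k)].

Definition TL : monCat k := {|
  ob := nat;
  hom := tl_hom;
  homI := fun a => tl_id a a;
  homC := tl_comp;
  tunit := 0%N;
  tob := addn;
  thom := tl_tens;
  assoc := fun a b c => tl_id (a + b + c) (a + (b + c));
  assocV := fun a b c => tl_id (a + (b + c)) (a + b + c);
  lunit := fun a => tl_id (0 + a) a;
  lunitV := fun a => tl_id a (0 + a);
  runit := fun a => tl_id (a + 0) a;
  runitV := fun a => tl_id a (a + 0)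
|}.

Definition tlV : dsum TL := @osum k TL 1%N.

Definition tl_coev : mor (unitd TL) (tensd tlV tlV) :=
  @Mor k TL (unitd TL) (tensd tlV tlV) (fun _ _ => tl_cup 0 0 (1 + 1)).
Definition tl_ev : mor (tensd tlV tlV) (unitd TL) :=
  @Mor k TL (tensd tlV tlV) (unitd TL) (fun _ _ => tl_cap 0 (1 + 1) 0).

(** * The complexes V_n *)

(* A set of disjoint pairs of neighbouring dots is given by the set of left
   members of its pairs: p stands for the pair {p, p+1}. *)
Definition is_pairing (n : nat) (s : {set 'I_n}) : bool :=
  [forall p in s, (p.+1 < n)%N && [forall r in s, r != p.+1 :> nat]].

(* I_{k,n} for k = - i. *)
Definition pairing (n : nat) (i : int) : finType :=
  {s : {set 'I_n} | is_pairing s && (#|s|%:Z == - i)}.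

Definition unpaired (n : nat) (s : {set 'I_n}) (j : 'I_n) : bool :=
  (j \notin s) && [forall p in s, p.+1 != j :> nat].

Definition cV_deg (n : nat) (i : int) : dsum TL :=
  @DSum k TL (pairing n i) (fun s => (n - #|val s|.*2)%N).

Definition cV_diff (n : nat) (i : int) : mor (cV_deg n i) (cV_deg n (i + 1)) :=
  @Mor k TL (cV_deg n i) (cV_deg n (i + 1)) (fun s s' =>
    if [pick p | (p \notin val s') && (val s == p |: val s')] is Some p then
      (-1) ^+ #|[set r in val s | (p < r)%N]|
        *: tl_cup #|[set j | unpaired (val s) j & (j < p)%N]|
             (n - #|val s|.*2) (n - #|val s'|.*2)
    else 0).

Definition cV (n : nat) : cplx TL := Cplx (@cV_diff n).

(* pi^(n+1): a pairing of the first n dots is viewed as a pairing of n+1 dots. *)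
Definition cV_pi (n : nat) : gmap (tensc (cV n) tlV) (cV n.+1) :=
  fun i => @Mor k TL (tensd (cV_deg n i) tlV) (cV_deg n.+1 i) (fun s s' =>
    if val s' == widen_ord (leqnSn n) @: val s.1
    then tl_id ((n - #|val s.1|.*2) + 1) (n.+1 - #|val s'|.*2)
    else 0).

(* The canonical identifications 1 = V_0 and V = V_1: for n <= 1 the only
   pairing is the empty one. *)
Definition cV_e0 : gmap (stalk (unitd TL)) (cV 0) :=
  fun i => @Mor k TL (stalk_dsum (unitd TL) i) (cV_deg 0 i)
    (fun _ s => tl_id 0 (0 - #|val s|.*2)).
Definition cV_e1 : gmap (stalk tlV) (cV 1) :=
  fun i => @Mor k TL (stalk_dsum tlV i) (cV_deg 1 i)
    (fun _ s => tl_id 1 (1 - #|val s|.*2)).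

End TemperleyLieb.

(* Main.v *)
Require Import Defs.
From mathcomp Require Import all_boot all_order all_algebra.
From mathcomp Require Import zify.
From Stdlib Require Import FunctionalExtensionality.
Set Implicit Arguments.
Unset Strict Implicit.
Unset Printing Implicit Defensive.
Set Bullet Behavior "Strict Subproofs".
Import GRing.Theory.
Local Open Scope ring_scope.

(** The pairings of [n + 2] dots are of two kinds.  Those in which the last two
    dots are not paired with each other leave the last dot unpaired, and they
    index the subcomplex [V_(n+1) V].  The others consist of the last pair and a
    pairing of the first [n] dots; they index the shift of [V_n] by one degree.
    The differential has two parts on the latter.  Removing the last pair
    creates a cup to the right of all strands, with sign +1 because no pair lies
    to its right: this is [iota^(n)].  Any other pair has one more pair on its
    right than it has as a pair of the first [n] dots, and the resulting sign -1
    is the one that the cone puts on the differential of [V_n].  Hence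
    [V_(n+2)] is isomorphic to the cone of [iota^(n)] as a complex, and under
    this isomorphism [pi^(n+2)] is the inclusion of [V_(n+1) V] in the cone.
    The triangle is therefore the standard triangle of a cone.

    All these complexes have the same shape ([framed]): their summands are
    labelled by pairings of [N] dots, and the entries of the differential are a
    function [cup_entry] of the labels alone.  All maps except [iota^(n)] send a
    summand identically to the summand with the same label ([inclusion]).
    Three facts about such complexes suffice: [framed_complex] (d d = 0, because
    two pairs can be removed in either order and the signs differ),
    [inclusion_chain] and [inclusion_comp].  In particular the cone of
    [iota^(n)] is a complex, and a block of its equation d d = 0 says that
    [iota^(n)] is a chain map ([cone_complex_chain]).

    In the Temperley-Lieb category this needs the unit laws, the relation
    between two cups created in either order ([comp_cup_cup]), the effect of
    adding strands beside a cup ([tens_cup_id], [tens_id_cup]), and the zigzag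
    relations for the duality.  A stack of two tangles is evaluated by sliding
    each of its points along its arc to an outer endpoint
    ([is_stack_retract]). *)

(** * Flat tangles: strands, cups and caps *)

Section Tangles.

Lemma tangle_neq a b (t : tangle a b) x : val t x != x.
Proof. by case: t => t /= /andP[/forallP/(_ x)/andP[]]. Qed.

Lemma tangleK a b (t : tangle a b) : involutive (val t).
Proof. by move=> x; case: t => t /= /andP[/forallP/(_ x)/andP[_ /eqP]]. Qed.

Lemma is_flatP a b (g : 'I_a + 'I_b -> 'I_a + 'I_b) :
  (forall x, g x != x) -> involutive g ->
  (forall x y, bpos x < bpos y -> bpos y < bpos (g x) ->
    bpos (g x) < bpos (g y) -> False)%N ->
  is_flat (finfun g).
Proof.
move=> gneq gK gnc; apply/andP; split.
  by apply/forallP => x; rewrite !ffunE gneq gK eqxx.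
apply/forallP => x; apply/forallP => y; rewrite /crossing !ffunE.
by apply/negP => /and3P[h1 h2 h3]; apply: gnc h1 h2 h3.
Qed.

Definition id_fun a (x : 'I_a + 'I_a) : 'I_a + 'I_a :=
  match x with inl i => inr i | inr i => inl i end.

Lemma id_flat a : is_flat (finfun (@id_fun a)).
Proof.
apply: is_flatP => [[i|i]|[i|i]|[i|i] [j|j]] //=; have := ltn_ord i;
  have := ltn_ord j; lia.
Qed.

Definition id_tangle a : tangle a a :=
  exist (fun t => is_flat t) (finfun (@id_fun a)) (id_flat a).

Section Cup.
Variables (a : nat) (i : 'I_a.+1).

Definition cup_l : 'I_a.+2 := widen_ord (leqnSn _) i.
Definition cup_r : 'I_a.+2 := lift ord0 i.
(** Written with [lift], so that [unlift] inverts it and finds the two points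
    of the cup among the top points. *)
Definition cup_skip (x : 'I_a) : 'I_a.+2 := lift cup_l (lift i x).

Definition cup_fun (w : 'I_a + 'I_a.+2) : 'I_a + 'I_a.+2 :=
  match w with
  | inl x => inr (cup_skip x)
  | inr y => if unlift cup_l y is Some z
             then if unlift i z is Some x then inl x else inr cup_l
             else inr cup_r
  end.

Lemma lift_cup : lift cup_l i = cup_r.
Proof. by apply: val_inj; rewrite /= /bump; lia. Qed.

Lemma cup_fun_l : cup_fun (inr cup_l) = inr cup_r.
Proof. by rewrite /= unlift_none. Qed.
Lemma cup_fun_r : cup_fun (inr cup_r) = inr cup_l.
Proof. by rewrite /= -lift_cup liftK unlift_none. Qed.
Lemma cup_fun_skip x : cup_fun (inr (cup_skip x)) = inl x.
Proof. by rewrite /= !liftK. Qed.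

Variant cup_top_spec : 'I_a.+2 -> Type :=
  | CupL : cup_top_spec cup_l
  | CupR : cup_top_spec cup_r
  | CupSkip x : cup_top_spec (cup_skip x).

Lemma cup_topP y : cup_top_spec y.
Proof.
case: (unliftP cup_l y) => [z ->|->]; last exact: CupL.
by case: (unliftP i z) => [x ->|->];
  [exact: CupSkip | rewrite lift_cup; exact: CupR].
Qed.

Lemma cup_skipE x : cup_skip x = (if (x < i)%N then x : nat else x.+2) :> nat.
Proof. by rewrite /= /bump; case: ltnP; lia. Qed.

Lemma cup_flat : is_flat (finfun cup_fun).
Proof.
have neq_lr : cup_l != cup_r by rewrite -val_eqE /= /bump; lia.
apply: is_flatP => [[x|y]|[x|y]|u v] //.
- case: (cup_topP y) => [||x]; rewrite ?cup_fun_l ?cup_fun_r ?cup_fun_skip //.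
  by rewrite [_ == _]eq_sym.
- by rewrite /= !liftK.
- by case: (cup_topP y) => [||x];
    rewrite ?cup_fun_l ?cup_fun_r ?cup_fun_l ?cup_fun_skip.
- have rev_bpos (y : 'I_a.+2) : (bpos (inr y : 'I_a + 'I_a.+2) + y).+1 =
    (a + a.+2)%N.
    by have := ltn_ord y; rewrite /=; lia.
  (* In the boundary coordinates [p] and [q] of its ends, an arc is either a
     strand from the bottom point [p] or the cup; what remains is linear
     arithmetic. *)
  pose arc p q := (exists2 x, (x < a)%N &
      ((x < i)%N /\ (q + x).+1 = (a + a.+2)%N \/ (i <= x)%N /\ (q + x).+3 =
        (a + a.+2)%N) /\ p = x)
    \/ (p + i).+1 = (a + a.+2)%N /\ (q + i).+2 = (a + a.+2)%N.
  have arcP w : arc (bpos w) (bpos (cup_fun w)) \/ arc (bpos (cup_fun w))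
    (bpos w).
    have skip_arc (x : 'I_a) : arc x (bpos (inr (cup_skip x) : 'I_a + 'I_a.+2)).
      left; exists (x : nat); first exact: ltn_ord.
      split=> //; have := rev_bpos (cup_skip x); rewrite cup_skipE.
      by case: ltnP => ?; [left | right]; split=> //; lia.
    have lr_arc : arc (bpos (inr cup_l : 'I_a + 'I_a.+2))
      (bpos (inr cup_r : 'I_a + 'I_a.+2)).
      by right; have := rev_bpos cup_l; have := rev_bpos cup_r;
        rewrite !lift0 /=; lia.
    case: w => [x|y]; first by left; exact: skip_arc.
    case: (cup_topP y) => [||x]; first by rewrite cup_fun_l; left.
      by rewrite cup_fun_r; right.
    by rewrite cup_fun_skip; right; exact: skip_arc.
  have := ltn_ord i; move: (arcP u) (arcP v);
    rewrite /arc {arcP rev_bpos neq_lr arc}.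
  move: (bpos u) (bpos v) (bpos (cup_fun u)) (bpos (cup_fun v)) (i : nat) =>
    p p' r r' m.
  case=> [[[x hx [hq hp]]|[hp hq]]|[[x hx [hq hp]]|[hp hq]]];
  case=> [[[x' hx' [hq' hp']]|[hp' hq']]|[[x' hx' [hq' hp']]|[hp' hq']]]; lia.
Qed.

Definition cup_tangle : tangle a a.+2 :=
  exist (fun t => is_flat t) (finfun cup_fun) cup_flat.

End Cup.

Definition swap_ends a b (x : 'I_a + 'I_b) : 'I_b + 'I_a :=
  match x with inl i => inr i | inr j => inl j end.

Lemma swap_endsK a b : cancel (@swap_ends a b) (@swap_ends b a).
Proof. by case. Qed.

Lemma bpos_swap a b (x : 'I_a + 'I_b) : (bpos (swap_ends x) + bpos x).+1 =
  (a + b)%N.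
Proof. by case: x => [x|x] /=; have := ltn_ord x; lia. Qed.

(** Reflection reverses the order of the endpoints along the boundary, so a
    crossing of the reflected tangle is a crossing of the tangle read backwards.
      *)
Lemma mirror_flat a b (t : tangle a b) :
  is_flat (finfun (@swap_ends a b \o val t \o @swap_ends b a)).
Proof.
apply: is_flatP => [x|x|x y] /=.
- by rewrite (can2_eq (@swap_endsK _ _) (@swap_endsK _ _)) tangle_neq.
- by rewrite swap_endsK tangleK swap_endsK.
- set x' := swap_ends x; set y' := swap_ends y => h1 h2 h3.
  have := bpos_swap x; have := bpos_swap y; rewrite -/x' -/y' => hy hx.
  have hx' := bpos_swap (val t x'); have hy' := bpos_swap (val t y').
  case: t h2 h3 hx' hy' => t /= /andP[/forallP ht /forallP h] h2 h3 hx' hy'.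
  have /forallP/(_ (t x')) := h (t y').
  rewrite /crossing.
  have -> : t (t x') = x' by have /andP[_ /eqP] := ht x'.
  have -> : t (t y') = y' by have /andP[_ /eqP] := ht y'.
  lia.
Qed.

Definition mirror a b (t : tangle a b) : tangle b a :=
  exist (fun t => is_flat t) _ (mirror_flat t).

End Tangles.

(** * Stacking *)

Section Stack.
Variables (a b c : nat) (beta : tangle b c) (alpha : tangle a b).

Lemma glue_lower u : connect (glue beta alpha) (lower c u)
  (lower c (val alpha u)).
Proof. by apply/connect1/orP; left; apply/existsP; exists u; rewrite !eqxx. Qed.

Lemma glue_upper v : connect (glue beta alpha) (upper a v)
  (upper a (val beta v)).
Proof. by apply/connect1/orP; right; apply/existsP; exists v;
  rewrite !eqxx. Qed.

Lemma connect_glue_invariant (T : Type) (L : stack_pt a b c -> T) :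
  (forall u, L (lower c u) = L (lower c (val alpha u))) ->
  (forall v, L (upper a v) = L (upper a (val beta v))) ->
  forall x y, connect (glue beta alpha) x y -> L x = L y.
Proof.
move=> Ll Lu x _ /connectP[p xp ->];
  elim: p x xp => //= y p IHp x /andP[xy /IHp <-].
by case/orP: xy => /existsP[u /andP[/eqP-> /eqP->]].
Qed.

Variables (r : stack_pt a b c -> 'I_a + 'I_c) (g : 'I_a + 'I_c -> 'I_a + 'I_c).
Hypothesis r_outer : forall w, r (outer b w) = w.
Hypothesis r_conn : forall x, connect (glue beta alpha) x (outer b (r x)).
Hypothesis gK : involutive g.
Hypothesis r_lower : forall u,
  r (lower c (val alpha u)) \in [:: r (lower c u); g (r (lower c u))].
Hypothesis r_upper : forall v,
  r (upper a (val beta v)) \in [:: r (upper a v); g (r (upper a v))].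
Hypothesis g_conn : forall w, connect (glue beta alpha) (outer b w)
  (outer b (g w)).

(** [r] slides every point of the stack along its arc to an outer endpoint, and
    [g] exchanges the two ends of an arc.  The unordered pair of ends
    [{r x, g (r x)}] is constant along arcs, so a tangle describing the stack
    cannot join [w] to anything but [g w]. *)
Lemma is_stack_retract gamma : is_stack beta alpha gamma =
  [forall w, val gamma w == g w].
Proof.
pose L x := [set r x; g (r x)].
have Lr x y : r y \in [:: r x; g (r x)] -> L x = L y.
  rewrite !inE => /orP[]/eqP; rewrite /L => ->; first by [].
  by rewrite gK setUC.
have LP := connect_glue_invariant (fun u => Lr _ _ (r_lower u))
  (fun v => Lr _ _ (r_upper v)).
apply/forallP/forallP => H w.
  have := LP _ _ (H w); rewrite /L !r_outer => e.
  have : val gamma w \in [set w; g w] by rewrite e set21.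
  by rewrite !inE (negPf (tangle_neq _ _)).
by rewrite (eqP (H w)).
Qed.

(** A point that slides to an outer endpoint lies on no circle. *)
Lemma circles_retract : circles beta alpha = 0%N.
Proof.
apply: eq_card0 => x; rewrite !inE; apply/negP => /andP[_ /forallP/(_ (r x))].
by rewrite r_conn.
Qed.

End Stack.

Section Linear.
Variables (k : comPzRingType) (delta : k).
Local Notation comp := (tl_comp delta).

Definition tl_single a b (t : tangle a b) : tl_hom k a b := tl_diag k (pred1 t).

Lemma tl_diagE a b P t : @tl_diag k a b P t = (P t)%:R.
Proof. by rewrite ffunE. Qed.

Lemma eq_tl_diag a b (P Q : pred (tangle a b)) : P =1 Q -> tl_diag k P =
  tl_diag k Q.
Proof. by move=> eqPQ; apply/ffunP => t; rewrite !ffunE eqPQ. Qed.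

Lemma comp0l a b c (f : tl_hom k a b) : comp (0 : tl_hom k b c) f = 0.
Proof.
apply/ffunP => t; rewrite !ffunE big1 // => al _; rewrite big1 // => be _.
by rewrite ffunE !mul0r.
Qed.

Lemma comp0r a b c (g : tl_hom k b c) : comp g (0 : tl_hom k a b) = 0.
Proof.
apply/ffunP => t; rewrite !ffunE big1 // => al _; rewrite big1 // => be _.
by rewrite ffunE mulr0 !mul0r.
Qed.

Lemma compZl a b c x (g : tl_hom k b c) (f : tl_hom k a b) : comp (x *: g) f =
  x *: comp g f.
Proof.
apply/ffunP => t; rewrite !ffunE scaler_sumr; apply: eq_bigr => al _.
by rewrite scaler_sumr; apply: eq_bigr => be _;
  rewrite ffunE /GRing.scale /= !mulrA.
Qed.

Lemma compZr a b c x (g : tl_hom k b c) (f : tl_hom k a b) : comp g (x *: f) =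
  x *: comp g f.
Proof.
apply/ffunP => t; rewrite !ffunE scaler_sumr; apply: eq_bigr => al _.
rewrite scaler_sumr; apply: eq_bigr => be _;
  rewrite ffunE /GRing.scale /= !mulrA.
by congr (_ * _ * _); rewrite mulrC.
Qed.

Lemma compNr a b c (g : tl_hom k b c) (f : tl_hom k a b) : comp g (- f) =
  - comp g f.
Proof. by rewrite -scaleN1r compZr scaleN1r. Qed.

Lemma sum_single (T : finType) (P : pred T) (t0 : T) (F : T -> k) :
  \sum_(t | P t) ((t == t0)%:R * F t) = (P t0)%:R * F t0.
Proof.
case: (boolP (P t0)) => Pt0; last first.
  rewrite mul0r big1 // => t Pt; case: eqP => [e|]; last by rewrite mul0r.
  by rewrite -e Pt in Pt0.
rewrite (bigD1 t0) //= eqxx big1 ?addr0 // => t /andP[_ /negPf->].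
by rewrite mul0r.
Qed.

Lemma comp_singlel a b c (beta : tangle b c) (f : tl_hom k a b) gamma :
  comp (tl_single beta) f gamma =
  \sum_alpha (is_stack beta alpha gamma)%:R *
    (f alpha * delta ^+ circles beta alpha).
Proof.
rewrite ffunE; apply: eq_bigr => al _.
rewrite -(@sum_single _ (fun be => is_stack be al gamma) beta
  (fun be => f al * delta ^+ circles be al)).
by apply: eq_bigr => be _; rewrite tl_diagE mulrA.
Qed.

Lemma comp_singler a b c (alpha : tangle a b) (g : tl_hom k b c) gamma :
  comp g (tl_single alpha) gamma =
  \sum_(beta | is_stack beta alpha gamma) g beta * delta ^+ circles beta alpha.
Proof.
rewrite ffunE (bigD1 alpha) //= [X in _ + X]big1 ?addr0.
  by apply: eq_bigr => be _; rewrite tl_diagE /= eqxx mulr1.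
move=> al /negPf ne; rewrite big1 // => be _.
by rewrite tl_diagE /= ne mulr0 mul0r.
Qed.

Lemma comp_single a b c (beta : tangle b c) (alpha : tangle a b) r g :
  (forall w, r (outer b w) = w) ->
  (forall x, connect (glue beta alpha) x (outer b (r x))) ->
  involutive g ->
  (forall u, r (lower c (val alpha u)) \in [:: r (lower c u);
    g (r (lower c u))]) ->
  (forall v, r (upper a (val beta v)) \in [:: r (upper a v);
    g (r (upper a v))]) ->
  (forall w, connect (glue beta alpha) (outer b w) (outer b (g w))) ->
  comp (tl_single beta) (tl_single alpha) =
  tl_diag k (fun gamma => [forall w, val gamma w == g w]).
Proof.
move=> h1 h2 h3 h4 h5 h6; apply/ffunP => gamma.
rewrite comp_singlel (eq_bigr (fun al => (al == alpha)%:R * ((is_stack beta al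
  gamma)%:R * delta ^+ circles beta al))).
  rewrite sum_single mul1r tl_diagE (circles_retract h2) mulr1.
  by rewrite (is_stack_retract h1 h3 h4 h5 h6).
by move=> al _; rewrite tl_diagE /= mulrCA.
Qed.

Lemma id_tangleE a : tl_id k a a = tl_single (id_tangle a).
Proof.
apply: eq_tl_diag => t; rewrite eqxx /=; apply/forallP/eqP => [H| -> i].
  apply: val_inj; apply/ffunP => x; rewrite ffunE.
  have H' i : val t (inl i) = inr i by have /forallP/(_ i) := H i;
    rewrite eqxx => /eqP/eqP.
  by case: x => i //=; rewrite -H' tangleK.
by apply/forallP => j; rewrite /= ffunE.
Qed.

(** A middle point is the lower end of a vertical strand, so it slides to the
    top, and the two ends of an arc of the stack are exchanged by [alpha]. *)
Lemma comp_idl a b (f : tl_hom k a b) : comp (tl_id k b b) f = f.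
Proof.
apply/ffunP => gamma; rewrite id_tangleE comp_singlel.
pose r (x : stack_pt a b b) : 'I_a + 'I_b :=
  match x with inl y => y | inr l => inr l end.
have P alpha : is_stack (id_tangle b) alpha gamma =
  (alpha == gamma) /\ circles (id_tangle b) alpha = 0%N.
  have h1 w : r (outer b w) = w by case: w.
  have h2 x : connect (glue (id_tangle b) alpha) x (outer b (r x)).
    case: x => [[i|j]|l]; try exact: connect0.
    by have := glue_upper (id_tangle b) alpha (inl j); rewrite /= ffunE.
  have h4 u : r (lower b (val alpha u)) \in [:: r (lower b u);
    val alpha (r (lower b u))].
    by rewrite !inE eqxx orbT.
  have h5 v : r (upper a (val (id_tangle b) v)) \in [:: r (upper a v);
    val alpha (r (upper a v))].
    by rewrite ffunE; case: v => i; rewrite !inE eqxx.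
  have h6 w : connect (glue (id_tangle b) alpha) (outer b w)
    (outer b (val alpha w)).
    have h7 w' : connect (glue (id_tangle b) alpha) (outer b w') (lower b w').
      case: w' => [i|j]; first exact: connect0.
      by have := glue_upper (id_tangle b) alpha (inr j); rewrite /= ffunE.
    apply: connect_trans (h7 w) _; apply: connect_trans (glue_lower _ _ _) _;
      exact: h2.
  split; last exact: circles_retract h2.
  rewrite (is_stack_retract h1 (tangleK alpha) h4 h5 h6).
  apply/forallP/eqP => [H| -> //]; apply: val_inj; apply/ffunP => x;
    exact/esym/eqP.
under eq_bigr => al _ do rewrite (P al).1 (P al).2 mulr1.
by rewrite sum_single mul1r.
Qed.

Lemma comp_idr a b (f : tl_hom k a b) : comp f (tl_id k a a) = f.
Proof.
apply/ffunP => gamma; rewrite id_tangleE comp_singler.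
pose r (x : stack_pt a a b) : 'I_a + 'I_b :=
  match x with inl (inl i) => inl i | inl (inr i) => inl i | inr l => inr l end.
have P beta : is_stack beta (id_tangle a) gamma =
  (beta == gamma) /\ circles beta (id_tangle a) = 0%N.
  have h1 w : r (outer a w) = w by case: w.
  have h2 x : connect (glue beta (id_tangle a)) x (outer a (r x)).
    case: x => [[i|j]|l]; try exact: connect0.
    by have := glue_lower beta (id_tangle a) (inr j); rewrite /= ffunE.
  have h4 u : r (lower b (val (id_tangle a) u)) \in [:: r (lower b u);
    val beta (r (lower b u))].
    by rewrite ffunE; case: u => i; rewrite !inE eqxx.
  have rU v : r (upper a v) = v by case: v.
  have h5 v : r (upper a (val beta v)) \in [:: r (upper a v);
    val beta (r (upper a v))].
    by rewrite !rU !inE eqxx orbT.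
  have h6 w : connect (glue beta (id_tangle a)) (outer a w)
    (outer a (val beta w)).
    have h7 w' : connect (glue beta (id_tangle a)) (outer a w') (upper a w').
      case: w' => [i|j]; last exact: connect0.
      by have := glue_lower beta (id_tangle a) (inl i); rewrite /= ffunE.
    apply: connect_trans (h7 w) _; apply: connect_trans (glue_upper _ _ _) _.
    by have := h2 (upper a (val beta w)); rewrite rU.
  split; last exact: circles_retract h2.
  rewrite (is_stack_retract h1 (tangleK beta) h4 h5 h6).
  apply/forallP/eqP => [H| -> //]; apply: val_inj; apply/ffunP => x;
    exact/esym/eqP.
under eq_bigr => be _ do rewrite (P be).2 mulr1.
by rewrite (eq_bigl (pred1 gamma)) ?big_pred1_eq // => be; rewrite (P be).1.
Qed.

End Linear.

(** * Cups can be created in either order *)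

Section Bottomless.
Variables (k : comPzRingType) (delta : k) (a b c : nat).
Variables (beta : tangle b c) (alpha : tangle a b) (phi : 'I_b -> 'I_c).
Hypothesis beta_phi : forall y, val beta (inl y) = inr (phi y).

Definition push (u : 'I_a + 'I_b) : 'I_a + 'I_c :=
  match u with inl x => inl x | inr y => inr (phi y) end.

Definition push_glue (w : 'I_a + 'I_c) : 'I_a + 'I_c :=
  match w with
  | inl x => push (val alpha (inl x))
  | inr l => match val beta (inr l) with
             | inl y => push (val alpha (inr y))
             | inr l' => inr l'
             end
  end.

Lemma beta_phiK y : val beta (inr (phi y)) = inl y.
Proof. by rewrite -beta_phi tangleK. Qed.

Lemma phi_beta l y : val beta (inr l) = inl y -> phi y = l.
Proof. by move=> e; have := tangleK beta (inr l);
  rewrite e beta_phi => -[]. Qed.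

Lemma push_glue_push u : push_glue (push u) = push (val alpha u).
Proof. by case: u => [x|y] //; rewrite /push_glue /push beta_phiK. Qed.

Variant push_spec : 'I_a + 'I_c -> Type :=
  | PushLower u : push_spec (push u)
  | PushUpper l l' of val beta (inr l) = inr l' : push_spec (inr l).

Lemma pushP w : push_spec w.
Proof.
case: w => [x|l]; first exact: (PushLower (inl x)).
case e: (val beta (inr l)) => [y|l']; last exact: PushUpper e.
have -> : inr l = push (inr y) by rewrite /push (phi_beta e).
exact: PushLower.
Qed.

Lemma push_glueK : involutive push_glue.
Proof.
move=> w; case: (pushP w) => [u|l l' e];
  first by rewrite !push_glue_push tangleK.
by rewrite /push_glue e -e tangleK.
Qed.

(** When [beta] joins no two of its bottom points, its strands carry the middle
    points injectively to top points.  The stack then consists of the arcs of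
    [alpha], moved by [phi], and of the arcs of [beta] between top points. *)
Lemma comp_single_push :
  tl_comp delta (tl_single k beta) (tl_single k alpha) =
  tl_diag k (fun gamma => [forall w, val gamma w == push_glue w]).
Proof.
pose r (x : stack_pt a b c) :=
  match x with inl u => push u | inr l => inr l end.
have h2 x : connect (glue beta alpha) x (outer b (r x)).
  case: x => [[x|y]|l]; try exact: connect0.
  by have := glue_upper beta alpha (inl y); rewrite beta_phi.
apply: (@comp_single k delta a b c beta alpha r push_glue) => //.
- by case.
- exact: push_glueK.
- by move=> u; rewrite !inE /= push_glue_push eqxx orbT.
- case=> [y|l]; first by rewrite beta_phi !inE eqxx.
  case e: (val beta (inr l)) => [y|l'].
    by rewrite /= (phi_beta e) !inE eqxx.
  by rewrite !inE /push_glue /= e eqxx orbT.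
- move=> w; case: (pushP w) => [u|l l' e].
    rewrite push_glue_push.
    apply: connect_trans (h2 (lower c (val alpha u))).
    apply: connect_trans (glue_lower beta alpha u).
    case: u => [x|y]; first exact: connect0.
    have := glue_upper beta alpha (inr (phi y)).
    by rewrite beta_phiK.
  by rewrite /push_glue e; have := glue_upper beta alpha (inr l); rewrite e.
Qed.

Lemma push_glue_eqP (gamma : tangle a c) :
  reflect ((forall u, val gamma (push u) = push (val alpha u)) /\
           (forall l l', val beta (inr l) = inr l' -> val gamma (inr l) =
             inr l'))
          [forall w, val gamma w == push_glue w].
Proof.
apply: (iffP forallP) => [H|[Hl Hu] w].
  by split=> [u|l l' e]; rewrite (eqP (H _)) ?push_glue_push // /push_glue e.
by case: (pushP w) => [u|l l' e];
  rewrite ?push_glue_push ?Hl // /push_glue e (Hu _ _ e).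
Qed.

End Bottomless.

Section Generators.
Variables (k : comPzRingType).

(** What is used of the tangle with a single cup, in terms of positions as
    numbers: the sizes of the objects of the complexes satisfy [b = a + 2] only
    as a proved equation.  By [cup_ind], a property that passes from one end of
    an arc to the other need only be checked at one end of each arc. *)
Record cup_like i a b (t : tangle a b) : Prop := {
  cup_through : forall x, exists2 y : 'I_b, val t (inl x) = inr y &
    y = (if (x < i)%N then (x : nat) else x.+2) :> nat;
  cup_arc : forall y : 'I_b, y = i :> nat ->
    exists2 y', val t (inr y) = inr y' & y' = i.+1 :> nat;
  cup_ind : forall P : 'I_a + 'I_b -> Prop,
    (forall u, P u -> P (val t u)) -> (forall x, P (inl x)) ->
    (forall y : 'I_b, y = i :> nat -> P (inr y)) -> forall u, P u
}.

Record cap_like i a b (t : tangle a b) : Prop := {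
  cap_through : forall x, exists2 y : 'I_a, val t (inr x) = inl y &
    y = (if (x < i)%N then (x : nat) else x.+2) :> nat;
  cap_arc : forall y : 'I_a, y = i :> nat ->
    exists2 y', val t (inl y) = inl y' & y' = i.+1 :> nat;
  cap_ind : forall P : 'I_a + 'I_b -> Prop,
    (forall u, P u -> P (val t u)) -> (forall x, P (inr x)) ->
    (forall y : 'I_a, y = i :> nat -> P (inl y)) -> forall u, P u
}.

Lemma cup_tangle_like a (i : 'I_a.+1) : cup_like i (cup_tangle i).
Proof.
split.
- by move=> x; exists (cup_skip i x); rewrite ?ffunE ?cup_skipE.
- move=> y yi; have -> : y = cup_l i by apply: val_inj.
  by exists (cup_r i); rewrite ?lift0 // ffunE cup_fun_l.
- move=> P Pt Px Py [x|y]; first exact: Px.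
  case: (cup_topP i y) => [||x]; first exact: Py.
    have -> : inr (cup_r i) = val (cup_tangle i) (inr (cup_l i))
      by rewrite ffunE cup_fun_l.
    by apply/Pt/Py.
  have -> : inr (cup_skip i x) = val (cup_tangle i) (inl x) by rewrite ffunE.
  by apply/Pt/Px.
Qed.

(** The two top points that are not reached by the strands can only be joined
    to each other. *)
Lemma eq_cup_tangle a (i : 'I_a.+1) (t : tangle a a.+2) :
  (forall x, val t (inl x) = inr (cup_skip i x)) -> t = cup_tangle i.
Proof.
move=> H; apply: val_inj; apply/ffunP => w; rewrite [RHS]ffunE.
have H' x : val t (inr (cup_skip i x)) = inl x by rewrite -H tangleK.
have not_skip x : (cup_skip i x != cup_l i) && (cup_skip i x != cup_r i).
  by rewrite -lift_cup /cup_skip (inj_eq lift_inj) ![lift _ _ == _]eq_sym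
    !neq_lift.
have Hl : val t (inr (cup_l i)) = inr (cup_r i).
  case e: (val t (inr (cup_l i))) => [x|y].
    have := tangleK t (inr (cup_l i)); rewrite e H => -[e'].
    by have /andP[/eqP[]] := not_skip x; exact: val_inj.
  case: (cup_topP i y) e => [||x] e //.
    by have := tangle_neq t (inr (cup_l i)); rewrite e eqxx.
  by have := tangleK t (inr (cup_l i)); rewrite e H'.
case: w => [x|y]; first by rewrite H.
case: (cup_topP i y) => [||x]; rewrite ?cup_fun_l ?cup_fun_r ?cup_fun_skip //.
by rewrite -Hl tangleK.
Qed.

Lemma tl_cup_tangle a (i : 'I_a.+1) : tl_cup k i a a.+2 =
  tl_single k (cup_tangle i).
Proof.
apply: eq_tl_diag => t; rewrite eqxx /= -ltnS ltn_ord /=.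
apply/forallP/eqP => [H| -> x]; last first.
  by apply/forallP => y; rewrite ffunE -cup_skipE;
    apply/eqP/(eq_sym (cup_skip i x : nat)).
apply: eq_cup_tangle => x; apply/eqP.
by have /forallP/(_ (cup_skip i x)) := H x; rewrite cup_skipE eqxx => /eqP->.
Qed.

Lemma tl_cupE i a b : b = a.+2 -> (i <= a)%N ->
  exists2 t : tangle a b, tl_cup k i a b = tl_single k t & cup_like i t.
Proof.
move=> -> ia; exists (cup_tangle (inord i : 'I_a.+1)).
  by rewrite -tl_cup_tangle inordK.
by have := cup_tangle_like (inord i : 'I_a.+1); rewrite inordK.
Qed.

Lemma mirrorE a b (t : tangle a b) x : val (mirror t) x =
  swap_ends (val t (swap_ends x)).
Proof. by rewrite ffunE. Qed.

Lemma mirrorK a b : cancel (@mirror a b) (@mirror b a).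
Proof.
move=> t; apply: val_inj; apply/ffunP => x.
by rewrite !mirrorE !swap_endsK.
Qed.

Lemma mirror_cup_like i a b (t : tangle a b) : cup_like i t ->
  cap_like i (mirror t).
Proof.
case=> H1 H2 H3; split.
- by move=> x; have [y e ye] := H1 x; exists y; rewrite // mirrorE /= e.
- by move=> y /H2[y' e e']; exists y'; rewrite // mirrorE /= e.
- move=> P Pt Px Py u; rewrite -(swap_endsK u).
  apply: (H3 (fun u => P (swap_ends u))) => // v /Pt.
  by rewrite mirrorE swap_endsK.
Qed.

Lemma tl_cap_tangle a (i : 'I_a.+1) :
  tl_cap k i a.+2 a = tl_single k (mirror (cup_tangle i)).
Proof.
apply: eq_tl_diag => t; rewrite eqxx /= -ltnS ltn_ord /=.
apply/forallP/eqP => [H| -> x]; last first.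
  by apply/forallP => y; rewrite mirrorE ffunE -cup_skipE;
    apply/eqP/(eq_sym (cup_skip i x : nat)).
rewrite -[t]mirrorK; congr mirror; apply: eq_cup_tangle => x.
rewrite mirrorE /=; have /forallP/(_ (cup_skip i x)) := H x.
by rewrite cup_skipE eqxx => /eqP/eqP->.
Qed.

Lemma tl_capE i a b : a = b.+2 -> (i <= b)%N ->
  exists2 t : tangle a b, tl_cap k i a b = tl_single k t & cap_like i t.
Proof.
move=> -> ia; exists (mirror (cup_tangle (inord i : 'I_b.+1))).
  by rewrite -tl_cap_tangle inordK.
by apply: mirror_cup_like; have := cup_tangle_like (inord i : 'I_b.+1);
  rewrite inordK.
Qed.

Lemma tl_cup0 i a b : (a < i)%N -> tl_cup k i a b = 0.
Proof.
move=> ia; apply/ffunP => t; rewrite tl_diagE ffunE.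
by rewrite [(i <= a)%N]leqNgt ia andbF.
Qed.

(** The arcs of a stack of two cups, each from one end; in this form the two
    orders of creation can be compared by positions. *)
Lemma comp_cup_tangle (delta : k) a (p : 'I_a.+1) (q : 'I_a.+3) :
  tl_comp delta (tl_single k (cup_tangle q)) (tl_single k (cup_tangle p)) =
  tl_diag k (fun gamma => [&& [forall x,
    val gamma (inl x) == inr (cup_skip q (cup_skip p x))],
     val gamma (inr (cup_skip q (cup_l p))) == inr (cup_skip q (cup_r p)) &
     val gamma (inr (cup_l q)) == inr (cup_r q)]).
Proof.
have qphi y : val (cup_tangle q) (inl y) = inr (cup_skip q y) by rewrite ffunE.
rewrite (comp_single_push _ _ qphi); apply: eq_tl_diag => gamma.
apply/(push_glue_eqP _ qphi)/and3P => [[Hl Hu]|[/forallP Hx /eqP Hc /eqP Hq]];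
  split.
- by apply/forallP => x; have := Hl (inl x); rewrite /= ffunE => ->.
- by have := Hl (inr (cup_l p)); rewrite ffunE cup_fun_l /= => ->.
- by apply/eqP/Hu; rewrite ffunE cup_fun_l.
- apply: (cup_ind (cup_tangle_like p)) => [u Hu|x|y yp].
  + by rewrite -Hu !tangleK.
  + by rewrite ffunE; exact: eqP (Hx x).
  + have -> : y = cup_l p by apply: val_inj.
    by rewrite ffunE cup_fun_l.
- move=> l l'; case: (cup_topP q l) => [||x];
    rewrite ffunE ?cup_fun_l ?cup_fun_r ?cup_fun_skip //.
    by case=> <-.
  by case=> <-; rewrite -Hq tangleK.
Qed.

(** A cup created to the left of the [j]-th position moves that position by 2.
    If [j > a] there is no room for the second cup, and both sides are 0. *)
Lemma comp_cup_cup (delta : k) i j a b b' c : (i <= j)%N ->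
  b = a.+2 -> b' = a.+2 -> c = a.+4 ->
  tl_comp delta (tl_cup k j.+2 b c) (tl_cup k i a b) =
  tl_comp delta (tl_cup k i b' c) (tl_cup k j a b').
Proof.
move=> ij -> -> ->; have [ja|aj] := leqP j a; last first.
  by rewrite tl_cup0 // (@tl_cup0 j) // comp0l comp0r.
have ia := leq_trans ij ja.
pose oi : 'I_a.+1 := inord i; pose oj : 'I_a.+1 := inord j.
pose oi' : 'I_a.+3 := inord i; pose oj' : 'I_a.+3 := inord j.+2.
have Ei : oi = i :> nat by rewrite inordK.
have Ej : oj = j :> nat by rewrite inordK.
have Ei' : oi' = i :> nat by rewrite inordK //; lia.
have Ej' : oj' = j.+2 :> nat by rewrite inordK.
rewrite -{1}Ei -{1}Ej' -{1}Ej -{1}Ei' !tl_cup_tangle.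
rewrite !comp_cup_tangle; apply: eq_tl_diag => gamma;
  rewrite [X in _ && X]andbC.
have -> : cup_skip oi' (cup_l oj) = cup_l oj'.
  by apply: ord_inj; rewrite cup_skipE; rewrite /= Ei' Ej Ej'; case: ltnP; lia.
have -> : cup_skip oi' (cup_r oj) = cup_r oj'.
  by apply: ord_inj; rewrite cup_skipE; rewrite !lift0 Ei' Ej Ej'; case: ltnP;
    lia.
have -> : cup_skip oj' (cup_l oi) = cup_l oi'.
  by apply: ord_inj; rewrite cup_skipE; rewrite /= Ei' Ei Ej'; case: ltnP; lia.
have -> : cup_skip oj' (cup_r oi) = cup_r oi'.
  by apply: ord_inj; rewrite cup_skipE; rewrite !lift0 Ei' Ei Ej'; case: ltnP;
    lia.
congr (_ && _); apply: eq_forallb => x; congr (_ == inr _); apply: ord_inj.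
rewrite !cup_skipE Ei Ej Ei' Ej'.
by case: (ltnP x j) => ?; case: (ltnP x i) => ?; do ?[case: ltnP => ?]; lia.
Qed.

End Generators.

(** * Juxtaposition and the zigzag relations *)

Section Juxtaposition.
Variable (k : comPzRingType).

Lemma tens0l a b c d (g : tl_hom k c d) : tl_tens (0 : tl_hom k a b) g = 0.
Proof.
apply/ffunP => t; rewrite !ffunE big1 // => al _; rewrite big1 // => be _.
by rewrite ffunE mul0r.
Qed.

Lemma tensZl a b c d x (f : tl_hom k a b) (g : tl_hom k c d) :
  tl_tens (x *: f) g = x *: tl_tens f g.
Proof.
apply/ffunP => t; rewrite !ffunE scaler_sumr; apply: eq_bigr => al _.
by rewrite scaler_sumr; apply: eq_bigr => be _;
  rewrite ffunE /GRing.scale /= !mulrA.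
Qed.

Variant juxt_spec a b c d : 'I_(a + c) + 'I_(b + d) -> Prop :=
  | JuxtL x : juxt_spec (@juxt_l a b c d x)
  | JuxtR y : juxt_spec (@juxt_r a b c d y).

Lemma juxtP a b c d w : @juxt_spec a b c d w.
Proof.
case: w => w; case: (splitP w) => z e.
- have -> : inl w = juxt_l c d (inl z : 'I_a + 'I_b) by congr inl;
    apply: ord_inj.
  exact: JuxtL.
- have -> : inl w = juxt_r a b (inl z : 'I_c + 'I_d) by congr inl;
    apply: ord_inj.
  exact: JuxtR.
- have -> : inr w = juxt_l c d (inr z : 'I_a + 'I_b) by congr inr;
    apply: ord_inj.
  exact: JuxtL.
- have -> : inr w = juxt_r a b (inr z : 'I_c + 'I_d) by congr inr;
    apply: ord_inj.
  exact: JuxtR.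
Qed.

Lemma tens_single a b c d (alpha : tangle a b) (beta : tangle c d) gamma :
  is_juxt alpha beta gamma ->
  tl_tens (tl_single k alpha) (tl_single k beta) = tl_single k gamma.
Proof.
move=> J; apply/ffunP => t;
  rewrite ffunE (bigD1 alpha) //= [X in _ + X]big1 ?addr0; last first.
  move=> al /negPf ne; rewrite big1 // => be _.
  by rewrite tl_diagE /= ne mul0r.
have -> : tl_single k gamma t = (is_juxt alpha beta t)%:R * 1.
  rewrite mulr1 tl_diagE /=; congr (_%:R); congr nat_of_bool.
  apply/eqP/idP => [-> //|/andP[/forallP tl /forallP tr]].
  case/andP: J => /forallP gl /forallP gr.
  apply: val_inj; apply/ffunP => w.
  case: (juxtP w) => [x|y]; first by rewrite (eqP (tl x)) (eqP (gl x)).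
  by rewrite (eqP (tr y)) (eqP (gr y)).
rewrite -(@sum_single k _ (fun be => is_juxt alpha be t) beta (fun=> 1)).
by apply: eq_bigr => be _; rewrite !tl_diagE /= eqxx mul1r mulr1.
Qed.

(** Agreement of a juxtaposition with its left factor passes from one end of an
    arc to the other, which is the inductive step of [cup_ind]. *)
Lemma juxt_l_step a b c d (alpha : tangle a b) (gamma : tangle (a + c) (b + d))
  u :
  val gamma (juxt_l c d u) == juxt_l c d (val alpha u) ->
  val gamma (juxt_l c d (val alpha u)) == juxt_l c d (val alpha (val alpha u)).
Proof. by move=> /eqP <-; rewrite !tangleK. Qed.

Lemma juxt_r_step a b c d (beta : tangle c d) (gamma : tangle (a + c) (b + d)) u
  :
  val gamma (juxt_r a b u) == juxt_r a b (val beta u) ->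
  val gamma (juxt_r a b (val beta u)) == juxt_r a b (val beta (val beta u)).
Proof. by move=> /eqP <-; rewrite !tangleK. Qed.

Lemma tens_id a b : tl_tens (tl_id k a a) (tl_id k b b) =
  tl_id k (a + b) (a + b).
Proof.
rewrite !id_tangleE; apply: tens_single; apply/andP.
by split; apply/forallP => -[x|x]; rewrite !ffunE.
Qed.

Lemma tens_cup_id i a b c : b = a.+2 -> (i <= a)%N ->
  tl_tens (tl_cup k i a b) (tl_id k c c) = tl_cup k i (a + c) (b + c).
Proof.
move=> ab ia; have [t -> [t1 t2 t3]] := tl_cupE k ab ia.
have [|s -> [s1 s2 _]] := @tl_cupE k i (a + c) (b + c) _
  (leq_trans ia (leq_addr _ _)).
  by rewrite ab.
rewrite id_tangleE; apply: tens_single; apply/andP; split; apply/forallP.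
- apply: t3 => [u|x|y yi]; first exact: juxt_l_step.
    have [y -> e] := t1 x; have [z -> e'] := s1 (lshift c x).
    by apply/eqP; congr inr; apply: ord_inj; rewrite e' /= e.
  have [y' -> e] := t2 y yi; have [z -> e'] := s2 (lshift c y) yi.
  by apply/eqP; congr inr; apply: ord_inj; rewrite e' /= e.
- have H x : val s (juxt_r a b (inl x)) =
    juxt_r a b (inr x) :> ('I_(a + c) + 'I_(b + c)).
    have [y -> e] := s1 (rshift a x); congr inr; apply: ord_inj;
      rewrite e /= ab.
    by case: ltnP => //; lia.
  by case=> x; rewrite ffunE [id_fun _]/= -H ?tangleK.
Qed.

Lemma tens_id_cup a : tl_tens (tl_id k a a) (tl_cup k 0 0 2) =
  tl_cup k a (a + 0) (a + 2).
Proof.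
have [t -> [t1 t2 t3]] := @tl_cupE k 0 0 2 erefl isT.
have [||s -> [s1 s2 _]] := @tl_cupE k a (a + 0) (a + 2);
  [by rewrite addn0 addn2 | by rewrite addn0 | ].
rewrite id_tangleE; apply: tens_single; apply/andP; split; apply/forallP.
- have H x : val s (juxt_l 0 2 (inl x)) =
    juxt_l 0 2 (inr x) :> ('I_(a + 0) + 'I_(a + 2)).
    by have [y -> e] := s1 (lshift 0 x); congr inr; apply: ord_inj;
      rewrite e /= ltn_ord.
  by case=> x; rewrite ffunE [id_fun _]/= -H ?tangleK.
- apply: t3 => [u|[] //|y yi]; first exact: juxt_r_step.
  have [y' -> e] := t2 y yi; have [|z -> e'] := s2 (rshift a y);
    first by rewrite /= yi addn0.
  by apply/eqP; congr inr; apply: ord_inj; rewrite e' /= e addn1.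
Qed.

Lemma tens_cap_id i a b c : a = b.+2 -> (i <= b)%N ->
  tl_tens (tl_cap k i a b) (tl_id k c c) = tl_cap k i (a + c) (b + c).
Proof.
move=> ab ia; have [t -> [t1 t2 t3]] := tl_capE k ab ia.
have [|s -> [s1 s2 _]] := @tl_capE k i (a + c) (b + c) _
  (leq_trans ia (leq_addr _ _)).
  by rewrite ab.
rewrite id_tangleE; apply: tens_single; apply/andP; split; apply/forallP.
- apply: t3 => [u|x|y yi]; first exact: juxt_l_step.
    have [y -> e] := t1 x; have [z -> e'] := s1 (lshift c x).
    by apply/eqP; congr inl; apply: ord_inj; rewrite e' /= e.
  have [y' -> e] := t2 y yi; have [z -> e'] := s2 (lshift c y) yi.
  by apply/eqP; congr inl; apply: ord_inj; rewrite e' /= e.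
- have H x : val s (juxt_r a b (inr x)) =
    juxt_r a b (inl x) :> ('I_(a + c) + 'I_(b + c)).
    have [y -> e] := s1 (rshift b x); congr inl; apply: ord_inj;
      rewrite e /= ab.
    by case: ltnP => //; lia.
  by case=> x; rewrite ffunE [id_fun _]/= -H ?tangleK.
Qed.

Lemma tens_id_cap a : tl_tens (tl_id k a a) (tl_cap k 0 2 0) =
  tl_cap k a (a + 2) (a + 0).
Proof.
have [t -> [t1 t2 t3]] := @tl_capE k 0 2 0 erefl isT.
have [||s -> [s1 s2 _]] := @tl_capE k a (a + 2) (a + 0);
  [by rewrite addn0 addn2 | by rewrite addn0 | ].
rewrite id_tangleE; apply: tens_single; apply/andP; split; apply/forallP.
- have H x : val s (juxt_l 2 0 (inr x)) =
    juxt_l 2 0 (inl x) :> ('I_(a + 2) + 'I_(a + 0)).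
    by have [y -> e] := s1 (lshift 0 x); congr inl; apply: ord_inj;
      rewrite e /= ltn_ord.
  by case=> x; rewrite ffunE [id_fun _]/= -H ?tangleK.
- apply: t3 => [u|[] //|y yi]; first exact: juxt_r_step.
  have [y' -> e] := t2 y yi; have [|z -> e'] := s2 (rshift a y);
    first by rewrite /= yi addn0.
  by apply/eqP; congr inl; apply: ord_inj; rewrite e' /= e addn1.
Qed.

Variable delta : k.

(** The stack is a single line through the middle points [m0], [m1], [m2].  As
    both outer endpoints are its ends, the middle points may all be slid to the
    bottom. *)
Lemma comp_zigzag (alpha : tangle 1 3) (beta : tangle 3 1) (m0 m1 m2 : 'I_3) :
  (forall m, m \in [:: m0; m1; m2]) ->
  val alpha (inl ord0) = inr m0 -> val beta (inl m0) = inl m1 ->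
  val alpha (inr m1) = inr m2 -> val beta (inl m2) = inr ord0 ->
  tl_comp delta (tl_single k beta) (tl_single k alpha) = tl_id k 1 1.
Proof.
move=> all3 e0 e1 e2 e3.
have inl1 (x : 'I_1) : x = ord0 by apply: ord1.
pose r (x : stack_pt 1 3 1) : 'I_1 + 'I_1 :=
  match x with inl (inl i) => inl i | inl (inr i) => inl ord0 | inr l =>
    inr l end.
have c0 : connect (glue beta alpha) (outer 3 (inl ord0)) (inl (inr m0)).
  by have := glue_lower beta alpha (inl ord0); rewrite e0.
have c1 : connect (glue beta alpha) (outer 3 (inl ord0)) (inl (inr m1)).
  by apply: connect_trans c0 _; have := glue_upper beta alpha (inl m0);
    rewrite e1.
have c2 : connect (glue beta alpha) (outer 3 (inl ord0)) (inl (inr m2)).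
  by apply: connect_trans c1 _; have := glue_lower beta alpha (inr m1);
    rewrite e2.
have c3 : connect (glue beta alpha) (outer 3 (inl ord0)) (outer 3 (inr ord0)).
  by apply: connect_trans c2 _; have := glue_upper beta alpha (inl m2);
    rewrite e3.
have csym : connect_sym (glue beta alpha).
  apply: (@sym_connect_sym _ (glue beta alpha)) => x y.
  have S x' y' : glue beta alpha x' y' -> glue beta alpha y' x'.
    case/orP => /existsP[u /andP[/eqP-> /eqP->]]; apply/orP; [left|right];
      apply/existsP.
      by exists (val alpha u); rewrite tangleK !eqxx.
    by exists (val beta u); rewrite tangleK !eqxx.
  by apply/idP/idP => /S.
have two (w w' : 'I_1 + 'I_1) : w \in [:: w'; id_fun w'].
  by case: w => x; case: w' => y; rewrite (inl1 x) (inl1 y).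
rewrite (@comp_single k delta 1 3 1 beta alpha r (@id_fun 1)) => //.
- rewrite id_tangleE; apply: eq_tl_diag => t /=; apply/forallP/eqP => [H| -> w];
    last by rewrite ffunE.
  by apply: val_inj; apply/ffunP => w; rewrite (eqP (H w)) ffunE.
- by case.
- case=> [[i|m]|l]; try exact: connect0.
  by rewrite csym; have := all3 m; rewrite !inE => /or3P[]/eqP->.
- by case.
- by case=> x; rewrite (inl1 x) //= csym.
Qed.

Lemma comp_cap_cup_r : tl_comp delta (tl_cap k 1 3 1) (tl_cup k 0 1 3) =
  tl_id k 1 1.
Proof.
have [t -> [t1 t2 _]] := @tl_cupE k 0 1 3 erefl isT.
have [s -> [s1 s2 _]] := @tl_capE k 1 3 1 erefl isT.
have [m0 e0 v0] := t1 ord0; have [m1 e1 v1] := t2 ord0 erefl.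
have [m2 e2 v2] := s2 m1 v1; have [m3 e3 v3] := s1 ord0.
have E2 : m2 = m0 by apply: ord_inj; rewrite v0 v2.
have E3 : m3 = ord0 by apply: ord_inj; rewrite v3.
apply: (@comp_zigzag _ _ m0 m1 ord0) => //.
- case=> [[|[|[|m]]] lm] //; rewrite !inE -!val_eqE /= v0 v1 //.
- by rewrite -E2 -e2 tangleK.
- by rewrite -e1 tangleK.
- by rewrite -E3 -e3 tangleK.
Qed.

Lemma comp_cap_cup_l : tl_comp delta (tl_cap k 0 3 1) (tl_cup k 1 1 3) =
  tl_id k 1 1.
Proof.
have [t -> [t1 t2 _]] := @tl_cupE k 1 1 3 erefl isT.
have [s -> [s1 s2 _]] := @tl_capE k 0 3 1 erefl isT.
have [m0 e0 v0] := t1 ord0; have [m1 e1 v1] := s2 m0 v0.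
have [m2 e2 v2] := t2 m1 v1; have [m3 e3 v3] := s1 ord0.
have E3 : m3 = m2 by apply: ord_inj; rewrite v3 v2.
apply: (@comp_zigzag _ _ m0 m1 m2) => //.
- case=> [[|[|[|m]]] lm] //; rewrite !inE -!val_eqE /= v0 v1 v2 //.
- by rewrite -E3 -e3 tangleK.
Qed.

End Juxtaposition.

(** * Pairings and the entries of the differential *)

Section Pairings.
Variable N : nat.
Implicit Types (s t z : {set 'I_N}) (p r j : 'I_N).

Lemma is_pairingP s :
  reflect (forall p, p \in s -> (p.+1 < N)%N /\ forall r,
    r \in s -> r <> p.+1 :> nat)
          (is_pairing s).
Proof.
apply: (iffP forallP) => H p.
  move=> ps; have := H p; rewrite ps /= => /andP[lt /forallP Hr];
    split=> // r rs.
  by have := Hr r; rewrite rs /= => /eqP.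
apply/implyP => ps; have [-> Hr] := H p ps; apply/forallP => r;
  apply/implyP => rs.
exact/eqP/Hr.
Qed.

Lemma is_pairing_sub s t : t \subset s -> is_pairing s -> is_pairing t.
Proof.
move=> /subsetP ts /is_pairingP H; apply/is_pairingP => p /ts ps.
by have [lt Hr] := H p ps; split=> // r /ts; apply: Hr.
Qed.

Lemma unpairedP s j : reflect (j \notin s /\ forall p,
  p \in s -> p.+1 <> j :> nat) (unpaired s j).
Proof.
apply: (iffP andP) => -[js H]; split=> //.
  by move=> p ps; move/forallP/(_ p): H; rewrite ps => /eqP.
by apply/forallP => p; apply/implyP => ps; apply/eqP/H.
Qed.

(** The paired dots are the left members, forming [s], and their successors.
    The cyclic successor [ordS] is used because it is injective on all dots; it
    agrees with the successor on [s]. *)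
Lemma card_unpaired s : is_pairing s ->
  (#|[set j | unpaired s j]| + #|s|.*2 = N)%N.
Proof.
move=> /is_pairingP sP.
have valS p : p \in s -> ordS p = p.+1 :> nat.
  by move=> /sP[lt _]; rewrite /= modn_small.
have -> : [set j | unpaired s j] = ~: (s :|: [set ordS p | p in s]).
  apply/setP => j; rewrite !inE negb_or; apply/unpairedP/andP => -[js H];
    split=> //.
    by apply/imsetP => -[p ps e]; apply: (H p ps); rewrite e valS.
  move=> p ps e; move/imsetP: H; apply; exists p => //.
  by apply: ord_inj; rewrite valS.
have -> : #|s|.*2 = #|s :|: [set ordS p | p in s]|.
  rewrite cardsU disjoint_setI0 ?cards0 ?subn0; last first.
    rewrite disjoint_subset; apply/subsetP => j js; rewrite inE;
      apply/imsetP => -[p ps e].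
    by have [_ /(_ _ js)] := sP _ ps; rewrite e valS.
  by rewrite card_imset -?addnn //; exact: ordS_inj.
by rewrite addnC cardsC card_ord.
Qed.

Lemma card_pairing s : is_pairing s -> (#|s|.*2 <= N)%N.
Proof. by move=> /card_unpaired; lia. Qed.

Definition strands_left s p := #|[set j | unpaired s j & (j < p)%N]|.
Definition pairs_right s p := #|[set r in s | (p < r)%N]|.

Lemma strands_left_le s p : is_pairing s -> (strands_left s p <= N - #|s|.*2)%N.
Proof.
move=> /card_unpaired sN.
suff : (strands_left s p <= #|[set j | unpaired s j]|)%N by lia.
by apply: subset_leq_card; apply/subsetP => j; rewrite !inE => /andP[].
Qed.

Lemma strands_left_mono s p r : (p <= r)%N ->
  (strands_left s p <= strands_left s r)%N.
Proof.
move=> pr; apply: subset_leq_card; apply/subsetP => j;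
  rewrite !inE => /andP[-> ] /=.
by move=> jp; apply: leq_trans jp pr.
Qed.

Lemma unpaired_add p t j : is_pairing (p |: t) -> p \notin t ->
  unpaired t j = [|| unpaired (p |: t) j, j == p | j == p.+1 :> nat].
Proof.
move=> /is_pairingP sP pt.
have ps : p \in p |: t := setU11 p t.
have ts r : r \in t -> r \in p |: t by exact: setU1r.
have [_ p_next] := sP p ps.
apply/unpairedP/or3P => [[jt H]|[/unpairedP[js H]|/eqP->|/eqP jp]].
- case: (eqVneq j p) => [|jp]; first by constructor 2.
  case: (eqVneq (j : nat) p.+1) => [|jp1]; first by constructor 3.
  constructor 1; apply/unpairedP; split; first by rewrite !inE negb_or jp.
  by move=> q; rewrite !inE => /orP[/eqP->|/H //]; apply/eqP; rewrite eq_sym.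
- split=> [|q qt]; first by move: js; rewrite !inE negb_or => /andP[].
  exact/H/ts.
- split=> // q qt; have [_ /(_ _ ps)] := sP _ (ts _ qt); exact: nesym.
- split; first by apply/negP => /ts/p_next.
  move=> q qt; rewrite jp => -[/ord_inj qp]; by rewrite -qp qt in pt.
Qed.

Lemma strands_left_add_ge p t r : is_pairing (p |: t) -> p \notin t ->
  (r <= p)%N ->
  strands_left t r = strands_left (p |: t) r.
Proof.
move=> sP pt rp; apply: eq_card => j; rewrite !inE (unpaired_add j sP pt).
case: (boolP (unpaired _ _)) => //= _; rewrite -val_eqE /=; apply/negbTE; lia.
Qed.

(** The freed dots [p] and [p + 1] both lie to the left of [r], since [p + 1]
    is not the left member of a pair. *)
Lemma strands_left_add_lt p t r : is_pairing (p |: t) -> p \notin t ->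
  r \in t -> (p < r)%N -> strands_left t r = (strands_left (p |: t) r).+2.
Proof.
move=> sP pt rt pr.
have ps : p \in p |: t := setU11 p t.
have [p1N p_next] := (is_pairingP _ sP) p ps.
pose p1 := Ordinal p1N.
have p1r : (p1 < r)%N by have := p_next _ (setU1r p rt); rewrite /=; lia.
rewrite /strands_left.
have -> : [set j | unpaired t j & (j < r)%N] = p |:
  (p1 |: [set j | unpaired (p |: t) j & (j < r)%N]).
  apply/setP => j; rewrite !inE (unpaired_add j sP pt).
  have -> : (j == p1) = (j == p.+1 :> nat) by [].
  case: eqP => [->|_]; first by rewrite pr !orbT.
  case: eqP => [jp|_]; first by rewrite jp p1r !orbT.
  by rewrite /= !orbF.
rewrite !cardsU1 !inE -!val_eqE /=.
have /negPf-> : ~~ unpaired (p |: t) p by apply/unpairedP => -[]; rewrite ps.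
have /negPf-> : ~~ unpaired (p |: t) p1 by apply/unpairedP => -[_ /(_ p ps)].
by rewrite /= orbF neq_ltn ltnSn.
Qed.

Lemma pairs_right_add p t r : p \notin t -> pairs_right (p |: t) r =
  ((r < p)%N + pairs_right t r)%N.
Proof.
move=> pt; rewrite /pairs_right.
have -> : [set x in p |: t | (r < x)%N] =
  (if (r < p)%N then [set p] else set0) :|: [set x in t | (r < x)%N].
  apply/setP => x; rewrite !inE; case: (eqVneq x p) => [->|xp] /=.
    by case: ltnP; rewrite ?inE ?eqxx ?(negPf pt).
  by case: (r < p)%N; rewrite !inE ?(negPf xp).
case: ltnP => rp; last by rewrite set0U.
by rewrite cardsU1 inE (negPf pt).
Qed.

End Pairings.

Section Entries.
Variables (k : comPzRingType) (delta : k) (N : nat).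
Implicit Types (s t z : {set 'I_N}) (p r j : 'I_N).

(** The entry of the differential with the sizes of source and target as free
    parameters, so that it also describes complexes with strands added on the
    right. *)
Definition cup_entry s t a b : tl_hom k a b :=
  if [pick p | (p \notin t) && (s == p |: t)] is Some p then
    (-1) ^+ pairs_right s p *: tl_cup k (strands_left s p) a b
  else 0.

Lemma cup_entry_add p t a b : p \notin t ->
  cup_entry (p |: t) t a b =
  (-1) ^+ pairs_right (p |: t) p *: tl_cup k (strands_left (p |: t) p) a b.
Proof.
move=> pt; rewrite /cup_entry; case: pickP => [r /andP[rt /eqP e]|/(_ p)];
  last by rewrite pt eqxx.
suff -> : r = p by [].
have : p \in r |: t by rewrite -e setU11.
by rewrite !inE (negPf pt) orbF => /eqP.
Qed.

Lemma cup_entry_eq0 s t a b : (forall p, p \notin t -> s <> p |: t) ->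
  cup_entry s t a b = 0.
Proof.
move=> H; rewrite /cup_entry; case: pickP => [p /andP[pt /eqP e]|] //.
by case: (H p).
Qed.

(** The squares of the differential.  Removing [p < r] in either order creates
    the same two cups.  The signs are opposite: [r] lies to the right of [p], so
    it is counted in the sign for [p] exactly when it is still present, while
    the sign for [r] does not see [p]. *)
Lemma comp_cup_entries s p r z a b b' c :
  is_pairing s -> p \notin z -> r \notin z -> (p < r)%N -> s = p |: (r |: z) ->
  b = a.+2 -> b' = a.+2 -> c = a.+4 ->
  tl_comp delta (cup_entry (r |: z) z b c) (cup_entry s (r |: z) a b) +
  tl_comp delta (cup_entry (p |: z) z b' c) (cup_entry s (p |: z) a b') = 0.
Proof.
move=> sP pz rz pr e ab ab' ac.
have ne : p != r by rewrite -val_eqE neq_ltn pr.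
have p_rz : p \notin r |: z by rewrite !inE negb_or ne.
have r_pz : r \notin p |: z by rewrite !inE negb_or eq_sym ne.
have e' : s = r |: (p |: z) by rewrite e setUCA.
rewrite (cup_entry_add _ _ pz) (cup_entry_add _ _ rz).
rewrite {1}e {1}e' (cup_entry_add _ _ p_rz) (cup_entry_add _ _ r_pz) -e -e'.
rewrite !compZl !compZr !scalerA.
rewrite (strands_left_add_lt _ p_rz (setU11 _ _) pr) -?e //.
rewrite (strands_left_add_ge _ r_pz (ltnW pr)) -?e' //.
rewrite (comp_cup_cup _ (strands_left_mono s (ltnW pr)) ab ab' ac).
rewrite -scalerDl {1}e {1}e' !pairs_right_add // ltnn pr (ltnNge r) (ltnW pr)
  /=.
by rewrite !add0n ltnn add0n add1n exprS mulN1r mulrN mulrC addNr scale0r.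
Qed.

End Entries.

(** * Adding an unpaired dot or a pair on the right *)

Section AddDot.
Variable n : nat.
Implicit Types (s t : {set 'I_n}) (p j : 'I_n).

Local Notation w := (widen_ord (leqnSn n)).
Definition add_dot s : {set 'I_n.+1} := w @: s.

Lemma widen_inj : injective w.
Proof. by move=> p r /(congr1 val) /= e; apply: ord_inj. Qed.

Lemma add_dot_inj : injective add_dot.
Proof. exact: imset_inj widen_inj. Qed.

Lemma mem_add_dot s p : (w p \in add_dot s) = (p \in s).
Proof. by rewrite mem_imset //; exact: widen_inj. Qed.

Lemma card_add_dot s : #|add_dot s| = #|s|.
Proof. by rewrite card_imset //; exact: widen_inj. Qed.

Lemma add_dotU1 p t : add_dot (p |: t) = w p |: add_dot t.
Proof. exact: imsetU1. Qed.

Lemma is_pairing_add_dot s : is_pairing s -> is_pairing (add_dot s).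
Proof.
move=> /is_pairingP sP; apply/is_pairingP => _ /imsetP[p /sP[lt H] ->] /=.
by split=> [|_ /imsetP[r /H rs ->]] //; lia.
Qed.

Lemma mem_add_dot_lt s (q : 'I_n.+1) : q \in add_dot s -> (q < n)%N.
Proof. by move=> /imsetP[p _ ->] /=. Qed.

(** The last dot is never the left member of a pair. *)
Lemma add_dot_preim (s : {set 'I_n.+1}) : is_pairing s -> exists t, s =
  add_dot t.
Proof.
move=> /is_pairingP sP; exists (w @^-1: s); apply/setP => q;
  apply/idP/imsetP => [qs|[p]].
  have [lt _] := sP q qs; have qn : (q < n)%N by [].
  have e : q = w (Ordinal qn) by apply: ord_inj.
  by exists (Ordinal qn); rewrite // inE -e.
by rewrite inE => ps ->.
Qed.

Lemma unpaired_add_dot s j : unpaired (add_dot s) (w j) = unpaired s j.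
Proof.
apply/unpairedP/unpairedP; rewrite mem_add_dot => -[js H]; split=> //.
  by move=> p ps; have := H (w p); rewrite mem_add_dot; apply.
by move=> _ /imsetP[p /H ne ->].
Qed.

Lemma strands_left_add_dotE s (q : 'I_n.+1) : (q <= n)%N ->
  strands_left (add_dot s) q = #|[set j | unpaired s j & (j < q)%N]|.
Proof.
move=> qn; rewrite -(card_add_dot [set j | unpaired s j & (j < q)%N]).
apply: eq_card => j; rewrite inE; apply/andP/imsetP => [[js jq]|[i]].
  have jn : (j < n)%N by apply: leq_trans jq qn.
  have e : j = w (Ordinal jn) by apply: ord_inj.
  by exists (Ordinal jn); rewrite // inE -unpaired_add_dot -e js.
by rewrite inE => /andP[iu iq] ->; rewrite unpaired_add_dot.
Qed.

Lemma strands_left_add_dot s p : strands_left (add_dot s) (w p) =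
  strands_left s p.
Proof. by rewrite strands_left_add_dotE //= ltnW. Qed.

Lemma strands_left_add_dot_max s : is_pairing s ->
  strands_left (add_dot s) ord_max = (n - #|s|.*2)%N.
Proof.
move=> /card_unpaired sN; rewrite strands_left_add_dotE //.
have -> : [set j | unpaired s j & (j < @ord_max n)%N] = [set j | unpaired s j].
  by apply/setP => j; rewrite !inE ltn_ord andbT.
by lia.
Qed.

Lemma pairs_right_add_dot s p : pairs_right (add_dot s) (w p) = pairs_right s p.
Proof.
rewrite /pairs_right -(card_add_dot [set r in s | (p < r)%N]);
  apply: eq_card => j.
rewrite inE; apply/andP/imsetP => [[/imsetP[r rs ->]] pr|[r]].
  by exists r; rewrite // inE rs.
by rewrite inE => /andP[rs pr] ->; rewrite mem_add_dot.
Qed.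

Lemma pairs_right_max s (q : 'I_n.+1) : (n <= q.+1)%N ->
  pairs_right (add_dot s) q = 0%N.
Proof.
move=> nq; apply: eq_card0 => j; rewrite inE;
  apply/negP => /andP[/mem_add_dot_lt].
by lia.
Qed.

Lemma cup_entry_add_dot (k : comPzRingType) s t a b :
  cup_entry k (add_dot s) (add_dot t) a b = cup_entry k s t a b.
Proof.
case: (pickP [pred p | (p \notin t) && (s == p |: t)]) =>
  [p /andP[/= pt /eqP->]|H].
  by rewrite add_dotU1 !cup_entry_add ?mem_add_dot // -add_dotU1
    pairs_right_add_dot strands_left_add_dot.
rewrite !cup_entry_eq0 // => [p pt e|q qt e].
  by have := H p; rewrite /= pt e eqxx.
have /imsetP[p ps qE] : q \in add_dot s by rewrite e setU11.
have := H p; rewrite /= -mem_add_dot -qE qt /= => /eqP; apply;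
  apply: add_dot_inj.
by rewrite add_dotU1 -qE.
Qed.

End AddDot.

Section AddPair.
Variables (k : comPzRingType) (n : nat).
Implicit Types (s t : {set 'I_n}).
Local Notation w := (widen_ord (leqnSn n.+1)).
Local Notation ww p := (w (widen_ord (leqnSn n) p)).
Local Notation last := (w ord_max).

Definition add_pair s : {set 'I_n.+2} := last |: add_dot (add_dot s).

Lemma last_notin_add_dot (t : {set 'I_n.+1}) : is_pairing t ->
  last \notin add_dot t.
Proof.
move=> /is_pairingP tP; rewrite mem_add_dot; apply/negP => /tP[]; rewrite /=;
  lia.
Qed.

Lemma last_notin s : last \notin add_dot (add_dot s).
Proof. by rewrite mem_add_dot; apply/negP => /mem_add_dot_lt; rewrite ltnn. Qed.

Lemma is_pairing_add_pair s : is_pairing s -> is_pairing (add_pair s).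
Proof.
move=> sP; have eP := is_pairing_add_dot (is_pairing_add_dot sP).
have /is_pairingP H := eP.
have lt q : q \in add_dot (add_dot s) -> (q.+1 < n)%N.
  by move=> /imsetP[_ /imsetP[p ps ->] ->] /=; have [] := is_pairingP _ sP p ps.
apply/is_pairingP => p; rewrite !inE => /orP[/eqP->|pe] /=.
  split=> // r; rewrite !inE => /orP[/eqP-> /=|/lt]; lia.
have [lt' Hr] := H p pe; split=> // r; rewrite !inE => /orP[/eqP-> /=|/Hr //].
by have := lt p pe; lia.
Qed.

Lemma card_add_pair s : #|add_pair s| = #|s|.+1.
Proof. by rewrite cardsU1 last_notin !card_add_dot. Qed.

Lemma add_pair_inj : injective add_pair.
Proof.
move=> s t e; apply: add_dot_inj; apply: add_dot_inj; apply/setP => q.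
move/setP/(_ q): e; rewrite !inE; case: eqP => //= -> _.
by rewrite (negPf (last_notin s)) (negPf (last_notin t)).
Qed.

Lemma strands_left_add_pair s (q : 'I_n.+2) : is_pairing s -> (q <= n)%N ->
  strands_left (add_pair s) q = strands_left (add_dot (add_dot s)) q.
Proof.
move=> sP qn; apply/esym/strands_left_add_ge => //; last exact: last_notin.
exact: is_pairing_add_pair.
Qed.

Lemma pairs_right_add_pair s (q : 'I_n.+2) :
  pairs_right (add_pair s) q =
    ((q < n)%N + pairs_right (add_dot (add_dot s)) q)%N.
Proof. by rewrite /add_pair pairs_right_add ?last_notin. Qed.

(** The added pair lies to the right of all others and changes the parity of
    the number of pairs to their right; it does not change what is to their
    left.  This sign is the one of the shifted differential. *)
Lemma cup_entry_add_pair s t a b : is_pairing s ->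
  cup_entry k (add_pair s) (add_pair t) a b = - cup_entry k s t a b.
Proof.
move=> sP.
case: (pickP [pred p | (p \notin t) && (s == p |: t)]) =>
  [p /andP[/= pt /eqP e]|H].
  have eC : add_pair s = ww p |: add_pair t
    by rewrite /add_pair e !add_dotU1 setUCA.
  have pl : (ww p < last)%N by rewrite /=.
  have pC : ww p \notin add_pair t.
    by rewrite !inE negb_or !mem_add_dot pt -val_eqE neq_ltn pl.
  rewrite eC (cup_entry_add _ _ _ pC) -eC e cup_entry_add // -e.
  rewrite pairs_right_add_pair pl !pairs_right_add_dot.
  rewrite (strands_left_add_pair sP (ltnW pl)) !strands_left_add_dot.
  by rewrite add1n exprS mulN1r scaleNr.
rewrite (@cup_entry_eq0 _ _ s) => [|p pt e]; last by have := H p;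
  rewrite /= pt e eqxx.
rewrite oppr0 cup_entry_eq0 // => q; rewrite !inE negb_or => /andP[ql qt] e.
have : q \in add_pair s by rewrite e setU11.
rewrite !inE (negPf ql) => /imsetP[_ /imsetP[p ps ->] qE].
have pt : p \notin t by move: qt; rewrite qE !mem_add_dot.
have := H p; rewrite /= pt => /eqP; apply; apply: add_pair_inj.
by rewrite e /add_pair !add_dotU1 -qE setUCA.
Qed.

(** A pairing in the image of [add_dot] does not contain the last pair, so it
    can only be obtained from [add_pair s] by removing that pair.  Then all
    unpaired dots of [s] lie to the left of the cup. *)
Lemma cup_entry_add_pair_add_dot s (t : {set 'I_n.+1}) a b : is_pairing s ->
  is_pairing t ->
  cup_entry k (add_pair s) (add_dot t) a b =
  if add_dot s == t then tl_cup k (n - #|s|.*2) a b else 0.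
Proof.
move=> sP tP; have lt := last_notin_add_dot tP; case: eqP => [<-|ne].
  rewrite cup_entry_add ?last_notin // -/(add_pair s) pairs_right_add_pair ltnn.
  rewrite (@strands_left_add_pair s last sP (leqnn n)) pairs_right_max // expr0
    scale1r.
  by rewrite strands_left_add_dot strands_left_add_dot_max.
rewrite cup_entry_eq0 // => q qt e; apply: ne; apply: add_dot_inj.
have ql : q = last.
  have : last \in q |: add_dot t by rewrite -e setU11.
  by rewrite !inE (negPf lt) orbF => /eqP.
apply/setP => r; move/setP/(_ r): e; rewrite ql !inE; case: eqP => //= -> _.
by rewrite (negPf lt) (negPf (last_notin s)).
Qed.

Lemma cup_entry_add_dot_add_pair s (t : {set 'I_n.+1}) a b : is_pairing t ->
  cup_entry k (add_dot t) (add_pair s) a b = 0.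
Proof.
move=> tP; rewrite cup_entry_eq0 // => q _ e.
have := last_notin_add_dot tP; rewrite e !inE eqxx orbT //.
Qed.

End AddPair.

(** * Complexes labelled by pairings *)

Section Matrices.
Variables (k : comPzRingType) (delta : k).
Local Notation C := (TL delta).
Local Notation comp := (tl_comp delta).

Lemma morP (X Y : dsum C) (f g : mor X Y) :
  (forall x y, f x y = g x y) -> f = g.
Proof.
case: f g => f [g] /= e; congr Mor.
apply: functional_extensionality_dep => x;
  apply: functional_extensionality_dep => y.
exact: e.
Qed.

Lemma gmapP (X Y : cplx C) (f g : gmap X Y) : (forall i, f i = g i) -> f = g.
Proof. by move=> e; apply: functional_extensionality_dep => i; exact: e. Qed.

Lemma compm_row (X Y Z : dsum C) (g : mor Y Z) (f : mor X Y) x z y0 :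
  (forall y, y != y0 -> f x y = 0) -> compm g f x z = comp (g y0 z) (f x y0).
Proof.
move=> f0; rewrite /compm /= (bigD1 y0) //= big1 ?addr0 // => y /f0 ->.
exact: comp0r.
Qed.

Lemma compm_col (X Y Z : dsum C) (g : mor Y Z) (f : mor X Y) x z y0 :
  (forall y, y != y0 -> g y z = 0) -> compm g f x z = comp (g y0 z) (f x y0).
Proof.
move=> f0; rewrite /compm /= (bigD1 y0) //= big1 ?addr0 // => y /f0 ->.
exact: comp0l.
Qed.

Lemma compm_eq0 (X Y Z : dsum C) (g : mor Y Z) (f : mor X Y) x z :
  (forall y, g y z = 0 \/ f x y = 0) -> compm g f x z = 0.
Proof.
move=> H; rewrite /compm /= big1 // => y _.
by case: (H y) => ->; [exact: comp0l | exact: comp0r].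
Qed.

Lemma monomialmE (X Y : dsum C) (h : idx X -> idx Y) (f : forall x,
  Defs.hom (X x) (Y (h x))) :
  (forall x, f x = tl_id k (X x) (Y (h x))) ->
  forall x y, monomialm f x y = if h x == y then tl_id k (X x) (Y y) else 0.
Proof.
move=> fE x y; rewrite /monomialm /=; case: eqP => // e.
by case: y / e; rewrite fE.
Qed.

Lemma idmE (X : dsum C) x y : idm X x y = if x ==
  y then tl_id k (X x) (X y) else 0.
Proof. exact: monomialmE. Qed.

Lemma compm_idl (X Y : dsum C) (f : mor X Y) : compm (idm Y) f = f.
Proof.
apply: morP => x y; rewrite (compm_col _ _ (y0 := y)) => [|z /negPf zy].
  by rewrite idmE eqxx; exact: comp_idl.
by rewrite idmE zy.
Qed.

Lemma compm_idr (X Y : dsum C) (f : mor X Y) : compm f (idm X) = f.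
Proof.
apply: morP => x y; rewrite (compm_row _ _ (y0 := x)) => [|z].
  by rewrite idmE eqxx; exact: comp_idr.
by rewrite eq_sym => /negPf zx; rewrite idmE zx.
Qed.

(** For objects whose sizes are equal by a proved equation, composing with
    [tl_id] amounts to a change of type. *)
Lemma comp_castr c (F : forall a, tl_hom k a c) a b : a = b ->
  comp (F b) (tl_id k a b) = F a.
Proof. by move=> <-; exact: comp_idr. Qed.

Lemma comp_castl a (F : forall b, tl_hom k a b) b c : b = c ->
  comp (tl_id k b c) (F b) = F c.
Proof. by move=> <-; exact: comp_idl. Qed.

Lemma tens_cast a b c : a = b -> tl_tens (tl_id k a b) (tl_id k c c) =
  tl_id k (a + c) (b + c).
Proof. by move=> <-; exact: tens_id. Qed.

End Matrices.

Section Frames.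
Variables (k : comPzRingType) (delta : k) (N : nat).
Local Notation C := (TL delta).
Local Notation comp := (tl_comp delta).

Definition labelling (A : cplx C) := forall i : int, idx (A i) -> {set 'I_N}.

(** [Q] selects the pairings that occur as labels: all of them for [V_N] and
    for the cone, those without the last pair for [V_(N-1) V], those with it for
    the shift of [V_(N-2)]. *)
Record framed (Q : pred {set 'I_N}) (A : cplx C) (l : labelling A) : Prop := {
  label_inj : forall i, injective (@l i);
  label_pairing : forall i x, is_pairing (@l i x);
  label_card : forall i x, #|@l i x|%:Z = - i;
  label_in : forall i x, Q (@l i x);
  label_onto : forall i s, is_pairing s -> #|s|%:Z = - i -> Q s ->
    exists x, @l i x = s;
  summand_size : forall i x, A i x = (N - #|@l i x|.*2)%N :> nat;
  diff_entry : forall i x y,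
    diff A i x y = cup_entry k (@l i x) (@l (i + 1) y) (A i x) (A (i + 1) y)
}.

(** All maps of the triangle other than [iota^(n)] have this form. *)
Definition inclusion A B (lA : labelling A) (lB : labelling B) : gmap A B :=
  fun i => Mor (fun x y => if lA i x == lB i y then tl_id k (A i x) (B i y) else
    0).

Section One.
Variables (Q : pred {set 'I_N}) (A : cplx C) (l : labelling A).
Hypothesis fA : framed Q l.

Lemma inclusion_refl : inclusion l l = @gid _ _ A.
Proof.
apply: gmapP => i; apply: morP => x y.
by rewrite /= [RHS]idmE (inj_eq (label_inj fA (i := i))).
Qed.

Lemma framed_bounded : bounded A.
Proof.
exists N%:Z => i iN; apply: morP => x.
have := card_pairing (label_pairing fA x); have := label_card fA x; lia.
Qed.

Lemma framed_bounded_above : bounded_above A.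
Proof.
exists N%:Z => i iN; apply: morP => x.
have := card_pairing (label_pairing fA x); have := label_card fA x; lia.
Qed.

(** Between two pairings that differ by the pairs [p] and [r] there are exactly
    two others.  The hypothesis says that if the two extreme ones occur as
    labels then so do the two in the middle, and their contributions cancel. *)
Lemma framed_complex :
  (forall s t u : {set 'I_N}, is_pairing s -> u \subset t -> t \subset s ->
    Q s -> Q u -> Q t) ->
  is_complex A.
Proof.
move=> Qconv i; apply: morP => x z; rewrite [RHS]/=.
set s := l x; set u := l z.
have size_diff i' (x' : idx (A i')) y' (y'' : idx (A y')) c : l x' = c |:
  l y'' -> c \notin l y'' ->
    A y' y'' = (A i' x').+2 :> nat.
  move=> e cn; rewrite !(summand_size fA) e.
  have := card_pairing (label_pairing fA x'); rewrite e cardsU1 cn; lia.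
(* Two pairs are removed: the entry vanishes unless s = p |: (r |: u). *)
have [/existsP[p /existsP[r /and4P[pr pu ru /eqP e]]]|no] :=
  boolP [exists p : 'I_N, exists r : 'I_N, [&& (p < r)%N, p \notin u,
    r \notin u & s == p |: (r |: u)]].
- have ne : p != r by rewrite -val_eqE neq_ltn pr.
  have sP : is_pairing s := label_pairing fA x.
  have e' : s = r |: (p |: u) by rewrite e setUCA.
  have p_ru : p \notin r |: u by rewrite !inE negb_or ne.
  have r_pu : r \notin p |: u by rewrite !inE negb_or eq_sym ne.
  have [y1 y1E] : exists y, l (i := i + 1) y = r |: u.
    have ts : r |: u \subset s by rewrite e subsetUr.
    apply: (label_onto fA); first exact: is_pairing_sub sP.
      by have := label_card fA x; rewrite -/s e cardsU1 p_ru; lia.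
    exact: Qconv sP (subsetUr _ _) ts (label_in fA x) (label_in fA z).
  have [y2 y2E] : exists y, l (i := i + 1) y = p |: u.
    have ts : p |: u \subset s by rewrite e' subsetUr.
    apply: (label_onto fA); first exact: is_pairing_sub sP.
      by have := label_card fA x; rewrite -/s e' cardsU1 r_pu; lia.
    exact: Qconv sP (subsetUr _ _) ts (label_in fA x) (label_in fA z).
  have y12 : y1 != y2.
    apply/eqP => y12; have : r \in p |: u by rewrite -y2E -y12 y1E setU11.
    by rewrite (negPf r_pu).
  rewrite /compm /= (bigD1 y1) //= (bigD1 y2) /=; last by rewrite eq_sym.
  rewrite big1 ?addr0 => [|y /andP[yy1 yy2]]; first last.
    rewrite !(diff_entry fA).
    case: (pickP [pred c | (c \notin u) && (l y == c |: u)]) =>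
      [c /andP[/= cu /eqP yE]|none]; last first.
      rewrite (@cup_entry_eq0 k N (l y)); first exact: comp0l.
      by move=> c cu yE; have := none c; rewrite /= cu yE eqxx.
    rewrite (@cup_entry_eq0 k N (l x)); first exact: comp0r.
    move=> d _ sE; have : c \in s by rewrite /s sE yE !inE eqxx orbT.
    rewrite e !inE (negPf cu) orbF => /orP[]/eqP ce.
      by case/eqP: yy2; apply: (label_inj fA); rewrite y2E yE ce.
    by case/eqP: yy1; apply: (label_inj fA); rewrite y1E yE ce.
  rewrite !(diff_entry fA) y1E y2E; apply: comp_cup_entries => //.
  + by apply: (size_diff _ _ _ _ p); rewrite y1E.
  + by apply: (size_diff _ _ _ _ r); rewrite y2E.
  + by rewrite (size_diff _ y1 _ z r) // (size_diff _ x _ y1 p) // y1E.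
- apply: compm_eq0 => y; rewrite !(diff_entry fA).
  case: (pickP [pred c | (c \notin u) && (l y == c |: u)]) =>
    [c /andP[/= cu /eqP yE]|none]; last first.
    left; apply: cup_entry_eq0 => c cu yE.
    by have := none c; rewrite /= cu yE eqxx.
  right; apply: cup_entry_eq0 => d dy sE; case/negP: no.
  have : d \notin c |: u by rewrite -yE.
  rewrite !inE negb_or -val_eqE neq_ltn => /andP[dc du].
  apply/existsP; case/orP: dc => [dc|cd].
    exists d; apply/existsP; exists c; by rewrite dc du cu /s sE yE eqxx.
  by exists c; apply/existsP; exists d; rewrite cd du cu /s sE yE setUCA eqxx.
Qed.

End One.

(** A label common to the first and the last complex must not be lost in the
    middle one. *)
Lemma inclusion_comp (QA QB QD : pred {set 'I_N}) A B D
    (lA : labelling A) (lB : labelling B) (lD : labelling D) :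
  framed QA lA -> framed QB lB -> framed QD lD ->
  (forall s, is_pairing s -> QA s -> QD s -> QB s) ->
  gcomp (inclusion lB lD) (inclusion lA lB) = inclusion lA lD.
Proof.
move=> fA fB fD sub; apply: gmapP => i; apply: morP => x z.
rewrite [RHS]/=; case: eqP => [xz|ne]; last first.
  apply: compm_eq0 => y /=; case: eqP => [yz|]; [right|by left].
  by case: eqP => // xy; case: ne; rewrite xy.
have [y yE] : exists y, lB i y = lA i x.
  apply: (label_onto fB); [exact: (label_pairing fA)|exact: (label_card fA)|].
  apply: sub; [exact: (label_pairing fA)|exact: (label_in fA)|].
  by rewrite xz; exact: (label_in fD).
rewrite (compm_row _ _ (y0 := y)) => [|y' /eqP ne]; last first.
  by rewrite /= -yE (inj_eq (label_inj fB (i := i))) eq_sym; case: eqP.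
rewrite /= yE xz eqxx; apply: (comp_castl _ (tl_id k (A i x))).
by rewrite (summand_size fB) (summand_size fD) yE xz.
Qed.

(** Both composites have as their entry from [x] to [z] the entry of the
    differential between these labels, provided that the label of [x] occurs in
    [B], respectively that the label of [z] occurs in [A]. *)
Lemma inclusion_chain (QA QB : pred {set 'I_N}) A B (lA : labelling A)
  (lB : labelling B) :
  framed QA lA -> framed QB lB ->
  (forall p t, is_pairing (p |: t) -> QA (p |: t) -> QB t -> QB (p |: t) = QA t)
    ->
  chain_map (inclusion lA lB).
Proof.
move=> fA fB QAB i; apply: morP => x z.
have sP := label_pairing fA x.
case: (pickP [pred p | (p \notin lB _ z) && (lA _ x == p |: lB _ z)]) =>
  [p /andP[pz /eqP e]|none]; last first.
  rewrite !compm_eq0 // => y.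
    rewrite (diff_entry fA) /=; case: eqP => [yz|]; [right|by left].
    apply: cup_entry_eq0 => p; rewrite yz => pz e.
    by have := none p; rewrite /= pz e eqxx.
  rewrite (diff_entry fB) /=; case: eqP => [xy|]; [left|by right].
  apply: cup_entry_eq0 => p pz e.
  by have := none p; rewrite /= pz xy e eqxx.
have zP := label_pairing fB z.
have zcard := label_card fB z.
have xcard := label_card fA x.
have := QAB p (lB _ z); rewrite -e => /(_ sP (label_in fA x) (label_in fB z)).
case: (boolP (QB (lA i x))) => [QBx /esym QAz|nQBx /esym/negbT nQAz].
- have [y yE] : exists y, lB i y = lA i x by apply: (label_onto fB).
  have [y' y'E] : exists y', lA (i + 1) y' = lB (i + 1) z by apply:
    (label_onto fA).
  rewrite (compm_row _ _ (y0 := y)) => [|y0 /eqP ne]; last first.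
    by rewrite /= -yE (inj_eq (label_inj fB (i := i))) eq_sym; case: eqP.
  rewrite (compm_col _ _ (y0 := y')) => [|y0 /eqP ne]; last first.
    by rewrite /= -y'E (inj_eq (label_inj fA (i := i + 1))); case: eqP.
  rewrite (diff_entry fA) (diff_entry fB) /= yE y'E !eqxx.
  rewrite (comp_castr _ (fun a => cup_entry k (lA i x) (lB (i + 1) z) a _)).
    rewrite (comp_castl _ (cup_entry k (lA i x) (lB (i + 1) z) (A i x))) //.
    by rewrite (summand_size fA) (summand_size fB) y'E.
  by rewrite (summand_size fA) (summand_size fB) yE.
- rewrite !compm_eq0 // => y; rewrite /=; [left|right]; case: eqP => // E.
    by case/negP: nQAz; rewrite -E; exact: (label_in fA).
  by case/negP: nQBx; rewrite E; exact: (label_in fB).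
Qed.

Lemma inclusion_iso (Q : pred {set 'I_N}) A B (lA : labelling A)
  (lB : labelling B) :
  framed Q lA -> framed Q lB ->
  (forall p t, is_pairing (p |: t) -> Q (p |: t) = Q t) ->
  cplx_iso (inclusion lA lB).
Proof.
move=> fA fB QE.
have QE' p t : is_pairing (p |: t) -> Q (p |: t) -> Q t -> Q (p |: t) = Q t
  by move=> /QE.
split; first exact: inclusion_chain QE'.
exists (inclusion lB lA); split; first exact: inclusion_chain QE'.
  by rewrite (inclusion_comp fA fB fA) // (inclusion_refl fA).
by rewrite (inclusion_comp fB fA fB) // (inclusion_refl fB).
Qed.

End Frames.

(** * The complexes of the triangle *)

Section Concrete.
Variables (k : comPzRingType) (delta : k).
Local Notation C := (TL delta).
Local Notation comp := (tl_comp delta).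
Local Notation V := (tlV delta).
Local Notation W := (cV delta).

Lemma is_pairing_val n i (s : pairing n i) : is_pairing (val s).
Proof. by have /andP[] := valP s. Qed.

Lemma card_pairing_val n i (s : pairing n i) : #|val s|%:Z = - i.
Proof. by have /andP[_ /eqP] := valP s. Qed.

Lemma pairing_ex n i (s : {set 'I_n}) : is_pairing s -> #|s|%:Z = - i ->
  exists x : pairing n i, val x = s.
Proof.
move=> sP sc.
have H : is_pairing s && (#|s|%:Z == - i) by rewrite sP sc eqxx.
by exists (exist (fun s => is_pairing s && (#|s|%:Z == - i)) s H).
Qed.

Definition cV_label n : labelling n (W n) := fun i (s : pairing n i) => val s.

Lemma cV_framed n : framed predT (@cV_label n).
Proof.
split=> //.
- by move=> i; exact: val_inj.
- by move=> i x; exact: is_pairing_val.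
- by move=> i x; exact: card_pairing_val.
- by move=> i s sP sc _; exact: pairing_ex.
Qed.

Lemma tens_cup_entry N (s t : {set 'I_N}) a b : is_pairing s ->
  a = (N - #|s|.*2)%N -> b = (N - #|t|.*2)%N ->
  tl_tens (cup_entry k s t a b) (tl_id k 1 1) = cup_entry k s t (a + 1) (b + 1).
Proof.
move=> sP -> ->.
case: (pickP [pred p | (p \notin t) && (s == p |: t)]) =>
  [p /andP[pt /eqP e]|H].
  rewrite e !cup_entry_add // tensZl tens_cup_id // -e ?strands_left_le //.
  have := card_pairing sP; rewrite e cardsU1 pt; lia.
rewrite !(@cup_entry_eq0 k N s) ?tens0l // => p pt e.
  by have := H p; rewrite /= pt e eqxx.
by have := H p; rewrite /= pt e eqxx.
Qed.

Definition last_paired N (s : {set 'I_N}) : bool := [exists p in s, p.+2 == N].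

Definition tens_label n : labelling n.+1 (tensc (W n) V) :=
  fun i x => add_dot (val x.1).

Lemma last_paired_add_dot n (s : {set 'I_n}) : is_pairing s ->
  ~~ last_paired (add_dot s).
Proof.
move=> /is_pairingP sP;
  apply/existsP => -[_ /andP[/imsetP[p /sP[lt _] ->] /eqP /=]].
by lia.
Qed.

Lemma pairing_add_dot_inv n (s : {set 'I_n.+1}) : is_pairing s ->
  ~~ last_paired s ->
  exists2 t, is_pairing t & s = add_dot t.
Proof.
move=> sP nl; have [t e] := add_dot_preim sP; exists t => //.
move/is_pairingP: sP => sP; apply/is_pairingP => p pt.
have ps : widen_ord (leqnSn n) p \in s by rewrite e mem_add_dot.
have [lt H] := sP _ ps; split.
  rewrite ltn_neqAle ltn_ord andbT; apply/eqP => pn; case/existsP: nl.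
  by exists (widen_ord (leqnSn n) p); rewrite ps /= pn.
by move=> r rt; apply: (H (widen_ord (leqnSn n) r)); rewrite e mem_add_dot.
Qed.

Lemma tens_framed n : framed (predC (@last_paired n.+1)) (@tens_label n).
Proof.
split.
- by move=> i [s []] [t []] /add_dot_inj/val_inj /= ->.
- by move=> i [s u]; exact/is_pairing_add_dot/is_pairing_val.
- by move=> i [s u]; rewrite /tens_label card_add_dot card_pairing_val.
- by move=> i [s u]; exact/last_paired_add_dot/is_pairing_val.
- move=> i s sP sc nl; have [t tP e] := pairing_add_dot_inv sP nl.
  have [|x xE] := @pairing_ex n i t tP; first by rewrite -(card_add_dot t) -e.
  by exists (x, tt); rewrite e /tens_label /= xE.
- move=> i [s u]; have := card_pairing (is_pairing_val s);
    rewrite /tens_label card_add_dot /=.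
  by move=> h; rewrite addn1 subSn.
- move=> i [s []] [t []]; rewrite /tens_label cup_entry_add_dot.
  rewrite -[LHS]/(tl_tens (@cV_diff k delta n i s t) (idm V tt tt)) idmE.
  by apply: tens_cup_entry; first exact: is_pairing_val.
Qed.

Definition shift_label n : labelling n.+2 (shift (W n)) :=
  fun i x => add_pair (val x).

Lemma last_paired_add_pair n (s : {set 'I_n}) : last_paired (add_pair s).
Proof.
apply/existsP; exists (widen_ord (leqnSn n.+1) ord_max).
by rewrite setU11 /=.
Qed.

(** The last pair excludes both neighbouring positions for left members, so the
    other pairs stay within the first [n] dots. *)
Lemma pairing_add_pair_inv n (s : {set 'I_n.+2}) : is_pairing s ->
  last_paired s ->
  exists2 t, is_pairing t & s = add_pair t.
Proof.
move=> sP /existsP[q /andP[qs /eqP qn]].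
have qE : q = widen_ord (leqnSn n.+1) ord_max by apply: ord_inj => /=; lia.
have sE : s = q |: (s :\ q) by rewrite setD1K.
have s'P : is_pairing (s :\ q) by apply: is_pairing_sub sP; exact: subsetDl.
have [t1 t1P e1] : exists2 t1, is_pairing t1 & s :\ q = add_dot t1.
  apply: pairing_add_dot_inv => //; apply/existsP => -[r /andP[]];
    rewrite !inE => /andP[rq _] /eqP rn.
  by case/eqP: rq; apply: ord_inj; lia.
have [t tP e] : exists2 t, is_pairing t & t1 = add_dot t.
  apply: pairing_add_dot_inv => //; apply/existsP => -[r /andP[rt /eqP rn]].
  have rs : widen_ord (leqnSn n.+1) r \in s.
    by move: (subsetDl s [set q]) => /subsetP; apply; rewrite e1 mem_add_dot.
  have [_ /(_ q qs)] := is_pairingP _ sP _ rs; case => /=; lia.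
by exists t; rewrite // sE e1 e qE.
Qed.

Lemma shift_framed n : framed (@last_paired n.+2) (@shift_label n).
Proof.
split.
- by move=> i s t /add_pair_inj/val_inj.
- by move=> i s; exact/is_pairing_add_pair/is_pairing_val.
- move=> i s; rewrite /shift_label card_add_pair; have := card_pairing_val s;
    lia.
- by move=> i s; exact: last_paired_add_pair.
- move=> i s sP sc nl; have [t tP e] := pairing_add_pair_inv sP nl.
  have [|x xE] := @pairing_ex n (i + 1) t tP; last by exists x;
    rewrite e /shift_label xE.
  by move: sc; rewrite e card_add_pair; lia.
- by move=> i s; rewrite /shift_label card_add_pair /=.
- move=> i s t; rewrite /shift_label cup_entry_add_pair //;
    exact: is_pairing_val.
Qed.

Section Iota.
Variable n : nat.
Local Notation iota := (cheb_iota (tl_coev delta) (cV_pi delta) n).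

(** Each of the three factors has a single nonzero entry in the row of a given
    summand, so the composite is one composite of tangles: strands, and a cup to
    the right of all of them. *)
Lemma coev_tens_entry (X : cplx C) i (x y : idx (X i)) u v :
  coev_tens (tl_coev delta) X i x ((y, u), v) =
  if x == y then tl_cup k (X i x) (X i x) (X i y + 1 + 1) else 0.
Proof.
case: u v => [] [].
have inner y' uv : compm (tensm (idm (X i)) (tl_coev delta)) (runitmV (X i)) x
  (y', uv) =
    if x == y' then tl_cup k (X i x) (X i x) (X i y' + 2) else 0.
  rewrite (compm_row _ _ (y0 := (x, tt) : idx (tensd (X i) (unitd C)))) =>
    [|z ne]; last first.
    by rewrite [LHS]monomialmE // eq_sym (negPf ne).
  rewrite [runitmV _ _ _]monomialmE // eqxx.
  rewrite -[tensm _ _ _ _]/(tl_tens (idm (X i) x y') (tl_cup k 0 0 2)) idmE;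
    case: eqP => [<-|_]; last by rewrite tens0l comp0l.
  rewrite tens_id_cup.
  by apply: (comp_castr _ (fun a => tl_cup k (X i x) a (X i x + 2)));
    exact: (esym (addn0 _)).
rewrite /coev_tens (compm_row _ _ (y0 := (x, (tt,
  tt)) : idx (tensd (X i) (tensd V V)))) => [|[y' [[] []]] ne]; last first.
  rewrite inner; case: eqP => // xy; case/eqP: ne; by rewrite xy.
rewrite inner eqxx [assocmV _ _ _ _ _]monomialmE //= !xpair_eqE !andbT.
case: eqP => [<-|_]; last exact: comp0l.
by apply: (comp_castl _ (tl_cup k (X i x) (X i x))); lia.
Qed.

Lemma iota_entry i (s : pairing n i) (t : pairing n.+1 i) u :
  iota i s (t, u) =
  if add_dot (val s) == val t then
    tl_cup k (n - #|val s|.*2) (n - #|val s|.*2) (n.+1 - #|val t|.*2 + 1)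
  else 0.
Proof.
case: u; rewrite /cheb_iota /gcomp (compm_row _ _ (y0 := ((s, tt),
  tt) : idx (tensd (tensd (W n i) V) V))) => [|[[y []] []] ne]; last first.
  rewrite coev_tens_entry; case: eqP => // sy; case/eqP: ne; by rewrite sy.
rewrite coev_tens_entry eqxx -[tensg _ _ _ _ _]/(tl_tens (cV_pi delta n i (s,
  tt) t) (idm V tt tt)) idmE /= eq_sym -/(add_dot (val s)).
case: eqP => [e|_]; last by rewrite tens0l comp0l.
have e' : add_dot (val s) = val t := e.
have h := card_pairing (is_pairing_val s).
have size : (n - #|val s|.*2 + 1 = n.+1 - #|val t|.*2)%N.
  by rewrite -e' card_add_dot; lia.
rewrite tens_cast; last exact: size.
apply: (comp_castl _ (tl_cup k _ _)).
by congr (_ + 1)%N; exact: size.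
Qed.

(** The labels of all pairings of [n + 2] dots, so that the cone of [iota^(n)]
    is [V_(n+2)] up to the names of its summands. *)
Definition cone_label : labelling n.+2 (cone iota) := fun i x =>
  match x with inl s => add_pair (val s) | inr t => add_dot (val t.1) end.

Lemma cone_framed : framed predT cone_label.
Proof.
have fS := shift_framed n; have fT := tens_framed n.+1.
split=> //.
- move=> i [s|t] [s'|t'] /=.
  + by move/(label_inj fS (i := i)) ->.
  + move=> e; have := last_paired_add_pair (val s); rewrite e.
    by rewrite (negPf (last_paired_add_dot (is_pairing_val _))).
  + move=> e; have := last_paired_add_pair (val s'); rewrite -e.
    by rewrite (negPf (last_paired_add_dot (is_pairing_val _))).
  + by move/(label_inj fT (i := i)) ->.
- by move=> i [s|t]; [exact: (label_pairing fS)|exact: (label_pairing fT)].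
- by move=> i [s|t]; [exact: (label_card fS)|exact: (label_card fT)].
- move=> i s sP sc _; case: (boolP (last_paired s)) => [lp|nl].
    by have [x <-] := label_onto fS sP sc lp; exists (inl x).
  by have [x <-] := label_onto fT sP sc nl; exists (inr x).
- by move=> i [s|t]; [exact: (summand_size fS)|exact: (summand_size fT)].
- move=> i [s|t] [s'|t'].
  + exact: (diff_entry fS).
  + case: t' => t' u; rewrite -[LHS]/(iota (i + 1) s (t', u)) iota_entry.
    by rewrite [RHS]cup_entry_add_pair_add_dot //; exact: is_pairing_val.
  + by rewrite /= cup_entry_add_dot_add_pair //; exact: is_pairing_val.
  + exact: (diff_entry fT).
Qed.

End Iota.

End Concrete.

(** * The triangle *)

Section Homotopy.
Variables (k : comPzRingType) (delta : k).
Local Notation C := (TL delta).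

Lemma gcomp_idl (A B : cplx C) (f : gmap A B) : gcomp (@gid _ _ B) f = f.
Proof. by apply: gmapP => i; exact: compm_idl. Qed.

Lemma gcomp_idr (A B : cplx C) (f : gmap A B) : gcomp f (@gid _ _ A) = f.
Proof. by apply: gmapP => i; exact: compm_idr. Qed.

Lemma homotopic_refl (A B : cplx C) (f : gmap A B) : homotopic f f.
Proof.
exists (fun i => zerom (A (i + 1)) (B i)) => i; apply: morP => x y /=.
rewrite subrr !big1 ?addr0 // => z _; [exact: comp0l | exact: comp0r].
Qed.

Lemma homotopy_iso_of_iso (A B : cplx C) (f : gmap A B) : cplx_iso f ->
  homotopy_iso f.
Proof.
case=> fc [g [gc gf fg]]; split=> //.
by exists g; rewrite gf fg; split=> //; exact: homotopic_refl.
Qed.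

Lemma gid_iso (A : cplx C) : cplx_iso (@gid _ _ A).
Proof.
have c : chain_map (@gid _ _ A) by move=> i;
  rewrite [LHS]compm_idr [RHS]compm_idl.
by split=> //; exists (@gid _ _ A); rewrite gcomp_idl.
Qed.

(** The chain map condition is the block from the source of [f] to its target of
    d d = 0 in the cone; the sign on the differential of the source turns the
    sum of two terms into their difference. *)
Lemma cone_complex_chain (A B : cplx C) (f : gmap A B) : is_complex (cone f) ->
  chain_map f.
Proof.
move=> cf i; rewrite -(subrK 1 i); move: (i - 1) => {}i.
apply: morP => x y; have /(congr1 (fun m : mor (cone f i) (cone f (i + 1 + 1))
  => m (inl x) (inr y))) := cf i.
rewrite /compm /= big_sumType /= => /eqP.
under eq_bigr => j _ do rewrite compNr.
by rewrite sumrN addrC subr_eq0 => /eqP.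
Qed.

End Homotopy.

Section Chebyshev.
Variables (k : comPzRingType) (delta : k).
Local Notation C := (TL delta).
Local Notation comp := (tl_comp delta).
Local Notation V := (tlV delta).
Local Notation W := (cV delta).
Local Notation iota n := (cheb_iota (tl_coev delta) (cV_pi delta) n).

(** All the sums of matrix products have a single term, which leaves the zigzag
    relations in the Temperley-Lieb category. *)
Lemma tl_self_dual : self_dual (tl_ev delta) (tl_coev delta).
Proof.
split; apply: morP => -[] [].
- rewrite (compm_row _ _ (y0 := (tt, tt) : idx (tensd V (unitd C))));
    last by move=> [[] []].
  rewrite (compm_row _ _ (y0 := (tt, (tt, tt)) : idx (tensd V (tensd V V))));
    last by move=> [[] [[] []]].
  rewrite (compm_row _ _ (y0 := ((tt, tt), tt) : idx (tensd (tensd V V) V)));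
    last by move=> [[[] []] []].
  rewrite (compm_row _ _ (y0 := (tt, tt) : idx (tensd (unitd C) V)));
    last by move=> [[] []].
  rewrite [runitm _ _ _]monomialmE // [assocm _ _ _ _ _]monomialmE //
    [lunitmV _ _ _]monomialmE // !eqxx.
  rewrite -[tensm (tl_coev _) _ _ _]/(tl_tens (tl_cup k 0 0 2) (idm V tt tt)).
  rewrite -[tensm _ (tl_ev _) _ _]/(tl_tens (idm V tt tt) (tl_cap k 0 2 0)).
  rewrite !idmE !eqxx tens_cup_id // (tens_id_cap k 1).
  rewrite -[LHS]/(comp (tl_id k 1 1) (comp (tl_cap k 1 3 1)
    (comp (tl_id k 3 3) (comp (tl_cup k 0 1 3) (tl_id k 1 1))))).
  by rewrite !comp_idl comp_idr comp_cap_cup_r.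
- rewrite (compm_row _ _ (y0 := (tt, tt) : idx (tensd (unitd C) V)));
    last by move=> [[] []].
  rewrite (compm_row _ _ (y0 := ((tt, tt), tt) : idx (tensd (tensd V V) V)));
    last by move=> [[[] []] []].
  rewrite (compm_row _ _ (y0 := (tt, (tt, tt)) : idx (tensd V (tensd V V))));
    last by move=> [[] [[] []]].
  rewrite (compm_row _ _ (y0 := (tt, tt) : idx (tensd V (unitd C))));
    last by move=> [[] []].
  rewrite [lunitm _ _ _]monomialmE // [assocmV _ _ _ _ _]monomialmE //
    [runitmV _ _ _]monomialmE // !eqxx.
  rewrite -[tensm _ (tl_coev _) _ _]/(tl_tens (idm V tt tt) (tl_cup k 0 0 2)).
  rewrite -[tensm (tl_ev _) _ _ _]/(tl_tens (tl_cap k 0 2 0) (idm V tt tt)).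
  rewrite !idmE !eqxx tens_cap_id // (tens_id_cup k 1).
  rewrite -[LHS]/(comp (tl_id k 1 1) (comp (tl_cap k 0 3 1)
    (comp (tl_id k 3 3) (comp (tl_cup k 1 1 3) (tl_id k 1 1))))).
  by rewrite !comp_idl comp_idr comp_cap_cup_l.
Qed.

Lemma pairing_le1 n (s : {set 'I_n}) : (n <= 1)%N -> is_pairing s -> s = set0.
Proof.
move=> n1 /is_pairingP sP; apply/setP => p; rewrite inE; apply/negP => /sP[].
by have := ltn_ord p; lia.
Qed.

Lemma cup_entry0 n a b : cup_entry k (set0 : {set 'I_n}) set0 a b = 0.
Proof. by apply: cup_entry_eq0 => p _ /setP/(_ p); rewrite !inE eqxx. Qed.

Definition stalk_label (a : ob C) : labelling a (stalk (osum a)) :=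
  fun _ _ => set0.
Arguments stalk_label : clear implicits.

(** Fewer than two dots have only the empty pairing. *)
Lemma stalk_framed (a : nat) : (a <= 1)%N -> framed predT (stalk_label a).
Proof.
move=> a1; split=> //.
- by move=> i x y _; apply: val_inj; case: (val x) (val y) => [] [].
- by move=> i x; apply/is_pairingP => p; rewrite inE.
- by move=> i x; rewrite cards0; have /eqP-> := valP x.
- move=> i s sP sc _; have s0 := pairing_le1 a1 sP.
  have i0 : i == 0 by move: sc; rewrite s0 cards0; lia.
  by exists (exist (fun _ : unit => i == 0) tt i0).
- by move=> i x; rewrite cards0 subn0.
- by move=> i x y; rewrite cup_entry0.
Qed.

Definition stalk_tens_label : labelling 1 (tensc (stalk (unitd C)) V) :=
  fun _ _ => set0.

Lemma stalk_tens_framed : framed predT stalk_tens_label.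
Proof.
have fS := @stalk_framed 0 isT; split=> //.
- move=> i [x []] [y []] _; congr (_, tt); exact: (label_inj fS).
- by move=> i x; apply/is_pairingP => p; rewrite inE.
- by move=> i [x u]; rewrite cards0; have /eqP-> := valP x.
- move=> i s sP sc _; have s0 := pairing_le1 (leqnn 1) sP.
  have i0 : i == 0 by move: sc; rewrite s0 cards0; lia.
  by exists (exist (fun _ : unit => i == 0) tt i0, tt).
- by move=> i x; rewrite cards0 subn0.
- by move=> i x y; rewrite cup_entry0 /= tens0l.
Qed.

Lemma cV_label_le1 n i (s : idx (W n i)) : (n <= 1)%N -> cV_label s = set0.
Proof. by move=> n1; apply: pairing_le1 n1 _; exact: is_pairing_val. Qed.

Lemma cV_e0_inclusion : cV_e0 delta =
  inclusion (stalk_label 0%N) (@cV_label _ delta 0).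
Proof. by apply: gmapP => i; apply: morP => x s;
  rewrite /= cV_label_le1 // eqxx. Qed.

Lemma cV_e1_inclusion : cV_e1 delta =
  inclusion (stalk_label 1%N) (@cV_label _ delta 1).
Proof. by apply: gmapP => i; apply: morP => x s;
  rewrite /= cV_label_le1 // eqxx. Qed.

Lemma cV_pi_inclusion n : @cV_pi _ delta n =
  inclusion (@tens_label _ delta n) (@cV_label _ delta n.+1).
Proof. by apply: gmapP => i; apply: morP => x s; rewrite /= eq_sym. Qed.

Lemma tensg_e0_inclusion : tensg V (cV_e0 delta) =
  inclusion stalk_tens_label (@tens_label _ delta 0).
Proof.
apply: gmapP => i; apply: morP => -[x []] [s []].
have s0 : val s = set0 := cV_label_le1 s isT.
rewrite -[LHS]/(tl_tens (cV_e0 delta i x s) (idm V tt tt)) idmE eqxx.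
rewrite [RHS]/=; case: eqP => [_|[]];
  last by rewrite -[RHS]/(add_dot (val s)) s0 /add_dot imset0.
exact: tens_cast (esym (sub0n _)).
Qed.

Lemma stalk_lunit_inclusion : @stalk_lunit _ C V =
  inclusion stalk_tens_label (stalk_label 1%N).
Proof.
apply: gmapP => i; apply: morP => x y.
by rewrite [LHS]monomialmE // [RHS]/= eqxx.
Qed.

Lemma add_pair_neq_add_dot n (s : {set 'I_n}) (t : {set 'I_n.+1}) :
  is_pairing t -> (add_pair s == add_dot t) = false.
Proof.
move=> tP; apply/eqP => e; have := last_paired_add_pair s.
by rewrite e (negPf (last_paired_add_dot tP)).
Qed.

Lemma cone_in_inclusion n : cone_in (iota n) =
  inclusion (@tens_label _ delta n.+1) (@cone_label _ delta n).
Proof.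
apply: gmapP => i; apply: morP => x [s|y].
  by rewrite [RHS]/= eq_sym add_pair_neq_add_dot //; exact: is_pairing_val.
rewrite -[LHS]/(idm (tensd (W n.+1 i) V) x y) idmE.
by rewrite -(inj_eq (label_inj (tens_framed delta n.+1) (i := i)) x y).
Qed.

Lemma cone_pr_inclusion n : cone_pr (iota n) =
  inclusion (@cone_label _ delta n) (@shift_label _ delta n).
Proof.
apply: gmapP => i; apply: morP => -[s|x] y.
  rewrite -[LHS]/(idm (W n (i + 1)) s y) idmE.
  by rewrite -(inj_eq (label_inj (shift_framed delta n) (i := i)) s y).
by rewrite [RHS]/= eq_sym add_pair_neq_add_dot //; exact: is_pairing_val.
Qed.

Lemma last_pairedS N p (t : {set 'I_N}) : last_paired t -> last_paired (p |: t).
Proof. by case/existsP => r /andP[rt rN]; apply/existsP; exists r;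
  rewrite setU1r. Qed.

(** The comparison with the standard triangle of the cone of [iota^(n)] is the
    identity on [V_n] and on [V_(n+1) V], and the isomorphism from [V_(n+2)]
    that identifies equal labels. *)
Lemma cV_triangle n : exists h : gmap (W n.+2) (shift (W n)),
  distinguished (@bounded k C) (iota n) (@cV_pi _ delta n.+1) h.
Proof.
have fW m := cV_framed delta m; have fT := tens_framed delta n.+1.
have fS := shift_framed delta n; have fC := cone_framed delta n.
exists (inclusion (@cV_label _ delta n.+2) (@shift_label _ delta n)).
have iota_chain : chain_map (iota n).
  by apply: cone_complex_chain; apply: framed_complex fC _.
split=> //.
  rewrite cV_pi_inclusion; apply: (inclusion_chain fT (fW _)) => p t _ /= nl _;
    apply/esym.
  by apply: contra nl; exact: last_pairedS.
  by apply: (inclusion_chain (fW _) fS) => p t _ _ /= /(last_pairedS p) ->.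
exists (W n), (tensc (W n.+1) V), (iota n), (@gid _ _ _), (@gid _ _ _).
exists (inclusion (@cV_label _ delta n.+2) (@cone_label _ delta n)).
have cx_n : is_complex (W n) by apply: framed_complex (fW n) _.
have cx_T : is_complex (tensc (W n.+1) V).
  apply: framed_complex fT _ => s t u _ _ /subsetP ts /= sl _.
  by apply: contra sl => /existsP[r /andP[/ts rs rN]]; apply/existsP; exists r;
    exact/andP.
split; first by split=> //;
  [exact: framed_bounded (fW n)|exact: framed_bounded fT].
  split; apply: homotopy_iso_of_iso; try exact: gid_iso.
  by apply: (inclusion_iso (fW _) fC).
split; first by rewrite gcomp_idl gcomp_idr; exact: homotopic_refl.
  rewrite gcomp_idr cV_pi_inclusion cone_in_inclusion
    (inclusion_comp fT (fW _) fC) //.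
  exact: homotopic_refl.
rewrite cone_pr_inclusion (inclusion_comp (fW _) fC fS) //.
by rewrite [gcomp _ _]gcomp_idl; exact: homotopic_refl.
Qed.

End Chebyshev.

Theorem theorem4p11 (k : comPzRingType) (q q' : k) (hq : q * q' = 1) :
  chebyshev_system (@bounded k (TL (q + q')))
    (V := tlV (q + q')) (W := cV (q + q'))
    (tl_ev (q + q')) (tl_coev (q + q'))
    (cV_e0 (q + q')) (cV_e1 (q + q')) (cV_pi (q + q')).
Proof.
move: (q + q') => delta; have fW n := cV_framed delta n.
have f1 := stalk_tens_framed delta.
have fS a (a1 : (a <= 1)%N) := stalk_framed delta a1.
split.
- exact: tl_self_dual.
- by move=> n; apply: framed_complex (fW n) _.
- by move=> n; exact: framed_bounded_above (fW n).
- by move=> n; exact: framed_bounded (fW n).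
- by rewrite cV_e0_inclusion; apply: (inclusion_iso (fS 0%N isT) (fW 0%N)).
- by rewrite cV_e1_inclusion; apply: (inclusion_iso (fS 1%N isT) (fW 1%N)).
- move=> n; rewrite cV_pi_inclusion;
    apply: (inclusion_chain (tens_framed delta n) (fW _)) => p t _ /= nl _.
  by apply/esym; apply: contra nl; exact: last_pairedS.
- rewrite cV_pi_inclusion tensg_e0_inclusion cV_e1_inclusion
    stalk_lunit_inclusion.
  rewrite (inclusion_comp f1 (tens_framed delta 0) (fW _)).
    by rewrite (inclusion_comp f1 (fS 1%N isT) (fW _)).
  move=> s sP _ _; rewrite (pairing_le1 (leqnn 1) sP) /=.
  by apply/existsP => -[p]; rewrite inE.
- exact: cV_triangle.
Qed.
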